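(* Fix $k\in\mathbb{N}$, and let $\sigma$ be uniformly random in $S_n$. Then $\frac{1}{\sqrt n}[n-\rho_\infty(\sigma)]$ is asymptotically weakly independent from the random vector $(\tilde\rho_1(\sigma),\ldots,\tilde\rho_k(\sigma))$ as $n\to\infty$, where $\tilde\rho_q=\frac{1}{\sqrt{\mathrm{var}\,\rho_q}}(\rho_q-\mathbb{E}\rho_q)$.
   Context: $S_n$ is the symmetric group on $[n]=\{1,\ldots,n\}$. For $1\le q<\infty$, $\rho_q(\sigma)=\sum_{i=1}^n|\sigma(i)-i|^q$, and $\rho_\infty(\sigma)=\max_{i\le n}|i-\sigma(i)|$. Means and variances are with respect to the uniform measure on $S_n$. Sequences $X_n$ (real-valued) and $Y_n$ ($\mathbb{R}^k$-valued) of random variables are weakly asymptotically independent if for all bounded continuous functions $f:\mathbb{R}\to\mathbb{R}$ and $g:\mathbb{R}^k\to\mathbb{R}$, $\lim_n\mathbb{E}[f(X_n)g(Y_n)]=\lim_n\mathbb{E}f(X_n)\,\lim_n\mathbb{E}g(Y_n)$. *)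

(* Defs.v *)
From mathcomp Require Import all_boot all_order all_algebra perm.
From mathcomp Require Import all_classical all_reals all_analysis.

Set Implicit Arguments.
Unset Strict Implicit.
Unset Printing Implicit Defensive.

Import Order.TTheory GRing.Theory Num.Theory.
Import numFieldNormedType.Exports.

Local Open Scope classical_set_scope.
Local Open Scope ring_scope.

Section UniformMeasure.
Variables (R : realType) (T : finType).

Definition unif_mean (F : T -> R) : R := (\sum_t F t) / #|T|%:R.

Definition unif_var (F : T -> R) : R :=
  unif_mean (fun t => (F t - unif_mean F) ^+ 2).

Definition standardize (F : T -> R) (t : T) : R :=
  (Num.sqrt (unif_var F))^-1 * (F t - unif_mean F).

End UniformMeasure.

(* [X n] and [Y n] are random variables on the finite set [T n], equipped with
   its uniform measure. The total operator [limn] is only meaningful for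
   convergent sequences, so the existence of the three limits is part of the
   definition. *)
Definition weakly_asymptotically_independent (R : realType) (k : nat)
    (T : nat -> finType) (X : forall n, T n -> R)
    (Y : forall n, T n -> 'rV[R]_k) : Prop :=
  forall (f : R -> R) (g : 'rV[R]_k -> R),
    continuous f -> bounded_fun f -> continuous g -> bounded_fun g ->
    let Ef n := unif_mean (fun t => f (X n t)) in
    let Eg n := unif_mean (fun t => g (Y n t)) in
    let Efg n := unif_mean (fun t => f (X n t) * g (Y n t)) in
    [/\ cvgn Ef, cvgn Eg, cvgn Efg & limn Efg = limn Ef * limn Eg].

(* ['S_n] acts on {0, ..., n-1} rather than {1, ..., n}; displacements are
   unaffected by the shift. *)
Definition displacement (n : nat) (s : 'S_n) (i : 'I_n) : nat :=
  `|(s i)%:Z - i%:Z|%N.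

Definition rho (R : realType) (n : nat) (q : R) (s : 'S_n) : R :=
  \sum_(i < n) (displacement s i)%:R `^ q.

Definition rho_infty (n : nat) (s : 'S_n) : nat :=
  \max_(i < n) displacement s i.

(* Main.v *)
(* Resampling one value of a uniform permutation [s] by a single transposition
   ([move i c s] sends [i] to [c]) couples the uniform law with the law
   conditioned on [s i = c]. This one coupling is used three times.
   - For a doubly centred array [a] of entries O(1/sqrt n) and
     [V s = \sum_i a i (s i)] it gives a Stein identity
     [E (V f(V)) = v E (f'(V)) + o(1)], [v = n^-1 \sum a^2]; with trigonometric
     [f] this is a differential equation for the characteristic function, whence
     [E cos (V + b)] tends to [exp (- v / 2) cos b]. Applied to linear
     combinations of the centred powers [|i - c|^q], whose covariances are
     Riemann sums, it yields the joint convergence of the standardized [rho_q].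
   - The board of the cells with [|i - c| >= n - r] has [r (r + 1)] cells.
     Removing them one at a time multiplies the probability that [s] avoids
     the board by [1 - 1/n], up to O(r / n^2); with [r = x sqrt n] it tends to
     [exp (- x^2)].
   - The same recursion holds with the indicator of avoidance multiplied by any
     bounded statistic that a transposition changes by o(1), such as [g(Y)]:
     hence the asymptotic independence.
   Bounded continuous functions are reached through step functions on the line,
   and through Bernstein polynomials in [sin (x_j / L)] on R^k. *)
Require Import Defs.
From mathcomp Require Import all_boot all_order all_algebra perm.
From mathcomp Require Import all_classical all_reals all_analysis.
From mathcomp Require Import ring lra zify.

Set Implicit Arguments.
Unset Strict Implicit.
Unset Printing Implicit Defensive.

Import Order.TTheory GRing.Theory Num.Theory.
Import numFieldNormedType.Exports.

Local Open Scope classical_set_scope.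
Local Open Scope ring_scope.

(** * Uniform permutations and transpositions *)

Section Mean.
Variables (R : realType) (T : finType).
Hypothesis T_gt0 : (0 < #|T|)%N.
Implicit Types F G : T -> R.
Local Notation E := (@unif_mean R T).

Lemma mean_const (c : R) : E (fun=> c) = c.
Proof.
rewrite /unif_mean sumr_const -[_ *+ _]mulr_natr mulfK //.
by rewrite pnatr_eq0 -lt0n.
Qed.

Lemma meanD F G : E (fun t => F t + G t) = E F + E G.
Proof. by rewrite /unif_mean big_split mulrDl. Qed.

Lemma meanZ c F : E (fun t => c * F t) = c * E F.
Proof. by rewrite /unif_mean -mulr_sumr mulrA. Qed.

Lemma meanN F : E (fun t => - F t) = - E F.
Proof. by rewrite /unif_mean sumrN mulNr. Qed.

Lemma meanB F G : E (fun t => F t - G t) = E F - E G.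
Proof. by rewrite meanD meanN. Qed.

Lemma mean_sum (I : Type) (r : seq I) (P : pred I) (F : I -> T -> R) :
  E (fun t => \sum_(i <- r | P i) F i t) = \sum_(i <- r | P i) E (F i).
Proof. by rewrite /unif_mean exchange_big mulr_suml. Qed.

Lemma mean_le F G : (forall t, F t <= G t) -> E F <= E G.
Proof. by move=> FG; rewrite /unif_mean ler_wpM2r ?invr_ge0 ?ler0n// ler_sum. Qed.

Lemma mean_norm F : `|E F| <= E (fun t => `|F t|).
Proof.
rewrite /unif_mean normrM [X in _ * X]ger0_norm ?invr_ge0 ?ler0n//.
by apply: ler_wpM2r; rewrite ?invr_ge0 ?ler0n// ler_norm_sum.
Qed.

Lemma mean_bound F c : (forall t, `|F t| <= c) -> `|E F| <= c.
Proof.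
by move=> Fc; rewrite (le_trans (mean_norm F))// -(mean_const c) mean_le.
Qed.

Lemma mean_dist F G H : (forall t, `|F t - G t| <= H t) ->
  `|E F - E G| <= E H.
Proof. by move=> FGH; rewrite -meanB (le_trans (mean_norm _))// mean_le. Qed.

End Mean.

Lemma sum_bound (R : realType) n (F : 'I_n -> R) (e : R) : (forall i, `|F i| <= e) ->
  `|\sum_i F i| <= n%:R * e.
Proof.
move=> Fe; rewrite (le_trans (ler_norm_sum _ _ _))//.
rewrite (le_trans (ler_sum _ (fun i _ => Fe i)))//.
by rewrite sumr_const card_ord -[leLHS]mulr_natl.
Qed.

Lemma card_Sn_gt0 n : (0 < #|{: 'S_n}|)%N.
Proof. by apply/card_gt0P; exists 1%g. Qed.
#[local] Hint Extern 0 (is_true (leq 1 _)) => exact: card_Sn_gt0 : core.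

Section Move.
Variables (R : realType) (n : nat).
Implicit Types (s : 'S_n) (i c : 'I_n).
Local Notation E := (@unif_mean R 'S_n).

Definition move i c s : 'S_n := (s * tperm (s i) c)%g.

(** The map sending [(c, s)] to [(s i, move i c s)] is an involution of pairs, so the double sum can
    be reindexed along it. *)
Lemma move_sum (G : 'I_n -> 'S_n -> R) i :
  n%:R * \sum_(s : 'S_n) G (s i) s = \sum_c \sum_s G c (move i c s).
Proof.
transitivity (\sum_(d < n) \sum_(s : 'S_n) G (s i) s).
  by rewrite sumr_const card_ord mulr_natl.
rewrite !pair_big/=.
pose h (p : 'I_n * 'S_n) := (p.2 i, move i p.1 p.2).
have hK : involutive h.
  move=> [c s]; rewrite /h /move /= permM tpermL; congr (_, _).
  by rewrite -mulgA tpermC tperm2 mulg1.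
rewrite (reindex_inj (inv_inj hK))/=.
by apply: eq_bigr => -[c s] _; rewrite /= permM tpermL.
Qed.

(* Resampling the value of [s] at [i] and repairing the permutation by one
   transposition produces the law of [s] conditioned on [s i]. *)
Lemma mean_move (G : 'I_n -> 'S_n -> R) i :
  E (fun s => G (s i) s) = n%:R^-1 * \sum_c E (fun s => G c (move i c s)).
Proof.
have n0 : n%:R != 0 :> R by rewrite pnatr_eq0; case: n i => [[]|].
by rewrite /unif_mean -mulr_suml -move_sum mulrA mulKf.
Qed.

(** Written with indicators so that sums over [j] collapse by [sum_perm_eq]. If [s i = c], the two
    corrections cancel. *)
Lemma moveE i c s j (b : 'I_n -> R) :
  b (move i c s j) = b (s j) + (s j == s i)%:R * (b c - b (s i))
    + (s j == c)%:R * (b (s i) - b c).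
Proof.
rewrite /move permM; case: tpermP => [->|->|/eqP/negPf-> /eqP/negPf->].
- by rewrite eqxx; case: eqVneq => [->|_] /=; ring.
- by rewrite eqxx; case: eqVneq => [->|_] /=; ring.
- by rewrite /=; ring.
Qed.

Lemma sum_perm_eq (b : 'I_n -> R) s c :
  \sum_j (s j == c)%:R * b j = b (s^-1 c)%g.
Proof.
rewrite (bigD1 (s^-1 c)%g)//= permKV eqxx mul1r big1 ?addr0// => j.
by rewrite -(inj_eq (@perm_inj _ s)) permKV => /negPf->; rewrite mul0r.
Qed.

Lemma sum_move i c s (b : 'I_n -> 'I_n -> R) :
  let j := (s^-1 c)%g in
  \sum_l b l (move i c s l) =
  \sum_l b l (s l) + (b i c - b i (s i)) + (b j (s i) - b j c).
Proof.
move=> j; under eq_bigr do rewrite moveE.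
by rewrite !big_split/= !sum_perm_eq permK.
Qed.

(** Only [i] and the preimage of [c] change value, each contributing at most [2 * K]. *)
Lemma sum_move_dist i c s (b : 'I_n -> 'I_n -> R) K :
  (forall l d, `|b l d| <= K) ->
  \sum_l `|b l (move i c s l) - b l (s l)| <= 4 * K.
Proof.
move=> bK; have K2 l d e : `|b l d - b l e| <= K + K.
  by rewrite (le_trans (ler_normB _ _))// lerD.
apply: (@le_trans _ _ (\sum_l ((s l == s i)%:R * (K + K) + (s l == c)%:R * (K + K)))).
  apply: ler_sum => l _.
  have eqD (x y z : R) : x + y + z - x = y + z by ring.
  rewrite moveE eqD (le_trans (ler_normD _ _))//.
  by rewrite lerD// normrM ger0_norm// ler_wpM2l.
rewrite big_split/= !sum_perm_eq; lra.
Qed.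

Lemma move_dist i c s (b : 'I_n -> 'I_n -> R) K :
  (forall l d, `|b l d| <= K) ->
  `|\sum_l b l (move i c s l) - \sum_l b l (s l)| <= 4 * K.
Proof.
move=> bK; rewrite -sumrB (le_trans (ler_norm_sum _ _ _))//.
exact: sum_move_dist.
Qed.

End Move.

(** * Stein's identity and characteristic functions *)

Lemma cos_lipschitz (R : realType) (x y : R) : `|cos y - cos x| <= `|y - x|.
Proof.
wlog xy : x y / x <= y => [H|].
  by case: (leP x y) => [|/ltW] /H//; rewrite distrC (distrC x).
have [c _ ->] : exists2 c, c \in `[x, y] & cos y - cos x = - sin c * (y - x).
  apply: (@MVT_segment R cos (fun z => - sin z) _ _ xy).
  by apply: continuous_subspaceT => z; apply: continuous_cos.
by rewrite normrM normrN ler_piMl// ler_norml sin_geN1 sin_le1.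
Qed.

Lemma sin_taylor (R : realType) (x y : R) :
  `|sin y - sin x - (y - x) * cos x| <= (y - x) ^+ 2.
Proof.
have H (u v : R) : u <= v ->
    exists2 c, c \in `[u, v] & sin v - sin u = cos c * (v - u).
  move=> uv; apply: (@MVT_segment R sin cos _ _ uv).
  by apply: continuous_subspaceT => z; apply: continuous_sin.
have [c cxy ->] : exists2 c, `|c - x| <= `|y - x| &
    sin y - sin x = cos c * (y - x).
  case: (leP x y) => [xy|/ltW xy].
    have [c] := H _ _ xy; rewrite in_itv/= => /andP[c1 c2] e; exists c => //.
    by rewrite !ger0_norm ?subr_ge0// lerD2r.
  have [c] := H _ _ xy; rewrite in_itv/= => /andP[c1 c2] e; exists c.
    by rewrite !ler0_norm ?subr_le0// lerN2 lerD2r.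
  by rewrite -opprB e; ring.
rewrite mulrC -mulrBr normrM -[leRHS]real_normK ?num_real// expr2.
by rewrite ler_wpM2l// (le_trans (cos_lipschitz _ _)).
Qed.

Section Stein.
Variables (R : realType) (n : nat) (a : 'I_n -> 'I_n -> R) (K : R).
Hypothesis a_row : forall i, \sum_c a i c = 0.
Hypothesis a_col : forall c, \sum_i a i c = 0.
Hypothesis aK : forall i c, `|a i c| <= K.
Hypothesis K_ge0 : 0 <= K.
Local Notation E := (@unif_mean R 'S_n).

Definition perm_sum (s : 'S_n) : R := \sum_i a i (s i).
(** The random part of what the resampling increments of [V] contribute to Stein's identity;
    [sum_sq] is the deterministic part. *)
Definition perm_cross (s : 'S_n) : R := \sum_i \sum_j a i (s j) * a j (s i).
Definition sum_sq : R := \sum_i \sum_c a i c ^+ 2.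

Local Notation V := perm_sum.
Local Notation U := perm_cross.

Let aaK i c j d : `|a i c * a j d| <= K ^+ 2.
Proof. by rewrite normrM expr2 ler_pM. Qed.

Lemma perm_cross_bound s : `|U s| <= n%:R ^+ 2 * K ^+ 2.
Proof.
by rewrite expr2 -mulrA; apply: sum_bound => i; apply: sum_bound => j; exact: aaK.
Qed.

(** The product rule leaves two sums; in each, one factor is at most [K] and, for each of the [n]
    rows, the changes of the other add up to at most [4 * K]. *)
Lemma perm_cross_move i c s : `|U (move i c s) - U s| <= 8 * n%:R * K ^+ 2.
Proof.
set s' := move i c s.
have D j : \sum_l `|a j (s' l) - a j (s l)| <= 4 * K.
  exact: (@sum_move_dist R n i c s (fun _ => a j)).
rewrite /perm_cross -sumrB (le_trans (ler_norm_sum _ _ _))//.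
apply: (@le_trans _ _ (\sum_k \sum_l
    (K * `|a k (s' l) - a k (s l)| + K * `|a l (s' k) - a l (s k)|))).
  apply: ler_sum => k _; rewrite -sumrB (le_trans (ler_norm_sum _ _ _))//.
  apply: ler_sum => l _.
  have -> : a k (s' l) * a l (s' k) - a k (s l) * a l (s k) =
     a l (s' k) * (a k (s' l) - a k (s l)) + a k (s l) * (a l (s' k) - a l (s k)).
    by ring.
  by rewrite (le_trans (ler_normD _ _))// !normrM lerD// ler_wpM2r.
under eq_bigr do rewrite big_split/=.
rewrite big_split/= [X in _ + X]exchange_big/= -mulr2n.
under eq_bigr do rewrite -mulr_sumr.
rewrite -mulr_sumr -[leLHS]mulr_natr.
have -> : 8 * n%:R * K ^+ 2 = K * (n%:R * (4 * K)) * 2 by ring.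
rewrite ler_wpM2r// ler_wpM2l// (le_trans (ler_sum _ (fun j _ => D j)))//.
by rewrite sumr_const card_ord -[leLHS]mulr_natl.
Qed.

(* One factor [U] is replaced by its terms conditioned on [s i = c]; without the
   changes caused by [move] these sum to [0] over [i]. *)
Lemma perm_cross_sq : E (fun s => U s ^+ 2) <= 12 * n%:R ^+ 3 * K ^+ 4.
Proof.
pose k i c s := \sum_j a i (s j) * a j c.
have kB i c s : `|k i c s| <= n%:R * K ^+ 2.
  by apply: sum_bound => j; exact: aaK.
have kM i c d e s : `|k i c (move d e s) - k i c s| <= 4 * K ^+ 2.
  exact: (@move_dist R n d e s (fun j x => a i x * a j c)).
have k0 c s : \sum_i k i c s = 0.
  rewrite /k exchange_big/= big1// => j _.
  by rewrite -mulr_suml a_col mul0r.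
have -> : E (fun s => U s ^+ 2) =
    \sum_i n%:R^-1 * \sum_c (E (fun s => k i c (move i c s) * U (move i c s))
                              - E (fun s => k i c s * U s)).
  under eq_fun do rewrite expr2 {1}/perm_cross mulr_suml.
  rewrite mean_sum.
  under eq_bigr => i _ do
    rewrite (mean_move (fun c s => (\sum_j a i (s j) * a j c) * U s)).
  rewrite -!mulr_sumr; congr (_ * _).
  under [RHS]eq_bigr do rewrite sumrB.
  rewrite sumrB [X in _ - X](_ : _ = 0) ?subr0//.
  rewrite exchange_big/= big1// => c _; rewrite -mean_sum.
  under eq_fun do rewrite -mulr_suml k0 mul0r.
  by rewrite mean_const.
apply: (le_trans (ler_norm _)); rewrite -mulr_sumr normrM ger0_norm ?invr_ge0//.
have [n0|n0] := posnP n.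
  by rewrite [X in X%:R^-1]n0 invr0 mul0r !mulr_ge0// exprn_ge0.
rewrite ler_pdivrMl ?ltr0n//.
have -> : n%:R * (12 * n%:R ^+ 3 * K ^+ 4) =
  n%:R * (n%:R * (12 * n%:R ^+ 2 * K ^+ 4)) by ring.
apply: sum_bound => i; apply: sum_bound => c.
rewrite -meanB//; apply: mean_bound => // s.
have -> : k i c (move i c s) * U (move i c s) - k i c s * U s =
  (k i c (move i c s) - k i c s) * U (move i c s) +
  k i c s * (U (move i c s) - U s) by ring.
have -> : 12 * n%:R ^+ 2 * K ^+ 4 = 4 * K ^+ 2 * (n%:R ^+ 2 * K ^+ 2) +
  n%:R * K ^+ 2 * (8 * n%:R * K ^+ 2) by ring.
rewrite (le_trans (ler_normD _ _))// !normrM lerD// ler_pM//.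
- exact: perm_cross_bound.
- exact: perm_cross_move.
Qed.

Lemma perm_sum_move i c s : `|V (move i c s) - V s| <= 4 * K.
Proof. exact: move_dist. Qed.

(** Expand the increment of [V] by [sum_move]. Terms free of [c] die by the row sums and
    [a (s^-1 c) c] by the column sums; what survives is the square and the mixed product. *)
Lemma sum_move_sq s (x y : R) :
  \sum_i \sum_c a i c * (x + y * (V (move i c s) - V s)) = y * (sum_sq + U s).
Proof.
have VE i c : V (move i c s) - V s =
    a i c - a i (s i) + (a (s^-1 c)%g (s i) - a (s^-1 c)%g c).
  by rewrite /perm_sum sum_move; ring.
have E1 i : \sum_c a i c * (x + y * (V (move i c s) - V s)) =
    y * (\sum_c a i c ^+ 2 + \sum_c a i c * a (s^-1 c)%g (s i)
      - \sum_c a i c * a (s^-1 c)%g c).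
  transitivity (\sum_c a i c * (x - y * a i (s i)) +
    y * (\sum_c a i c ^+ 2 + \sum_c a i c * a (s^-1 c)%g (s i)
      - \sum_c a i c * a (s^-1 c)%g c)).
    rewrite -big_split/= -sumrB mulr_sumr -big_split/=.
    by apply: eq_bigr => c _; rewrite VE; ring.
  by rewrite -mulr_suml a_row mul0r add0r.
under eq_bigr do rewrite E1.
rewrite -mulr_sumr sumrB big_split/=.
have -> : \sum_i \sum_c a i c * a (s^-1 c)%g (s i) = U s.
  apply: eq_bigr => i _; rewrite (reindex_inj (@perm_inj _ s))/=.
  by apply: eq_bigr => j _; rewrite permK.
rewrite [X in _ - X](_ : _ = 0) ?subr0//.
rewrite exchange_big/= big1// => c _.
by rewrite -mulr_suml a_col mul0r.
Qed.

(** Resample at each [i] and expand [f] around [V s]. [sum_move_sq] evaluates the affine part; the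
    remainder costs at most [K * (L * (4 * K) ^+ 2)] for each of the [n ^ 2] pairs [(i, c)]. *)
Lemma stein (f f' : R -> R) (L : R) : 0 <= L ->
  (forall x y, `|f y - f x - (y - x) * f' x| <= L * (y - x) ^+ 2) ->
  `|E (fun s => V s * f (V s)) - n%:R^-1 * E (fun s => f' (V s) * (sum_sq + U s))|
   <= 16 * L * n%:R * K ^+ 3.
Proof.
move=> L0 fL.
have -> : E (fun s => V s * f (V s)) =
    n%:R^-1 * \sum_i \sum_c E (fun s => a i c * f (V (move i c s))).
  under eq_fun do rewrite {1}/perm_sum mulr_suml.
  rewrite mean_sum mulr_sumr; apply: eq_bigr => i _.
  by rewrite (mean_move (fun c s => a i c * f (V s))).
have -> : E (fun s => f' (V s) * (sum_sq + U s)) =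
    \sum_i \sum_c E (fun s => a i c * (f (V s) + f' (V s) * (V (move i c s) - V s))).
  under [in LHS]eq_fun => s do rewrite -(sum_move_sq s (f (V s))).
  by rewrite mean_sum; apply: eq_bigr => i _; rewrite mean_sum.
rewrite -mulrBr normrM ger0_norm ?invr_ge0//.
have [n0|n0] := posnP n.
  by rewrite [X in X%:R^-1]n0 invr0 mul0r !mulr_ge0// exprn_ge0.
rewrite ler_pdivrMl ?ltr0n//.
have -> : n%:R * (16 * L * n%:R * K ^+ 3) =
  n%:R * (n%:R * (K * (L * (4 * K) ^+ 2))) by ring.
rewrite -sumrB; apply: sum_bound => i; rewrite -sumrB; apply: sum_bound => c.
rewrite -meanB//; apply: mean_bound => // s.
rewrite -mulrBr normrM ler_pM//.
rewrite opprD addrA [X in _ - X]mulrC (le_trans (fL _ _))// ler_wpM2l//.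
by rewrite -real_normK ?num_real// lerXn2r ?nnegrE ?mulr_ge0// perm_sum_move.
Qed.

(** The identity function has no Taylor remainder, so Stein's identity with [L = 0] is exact. *)
Lemma mean_perm_sum_sq : E (fun s => V s ^+ 2) = n%:R^-1 * E (fun s => sum_sq + U s).
Proof.
have := @stein id (fun=> 1) 0 (lexx _).
have idL (x y : R) : `|y - x - (y - x) * 1| <= 0 * (y - x) ^+ 2.
  by rewrite mulr1 subrr normr0 mul0r.
rewrite mulr0 !mul0r => /(_ idL).
rewrite normr_le0 subr_eq0 => /eqP.
by under [in X in _ = X -> _]eq_fun do rewrite mul1r.
Qed.

(** The arithmetic-geometric inequality [|U| <= U^2 / (2 y) + y / 2], with [y] left free for later
    balancing. *)
Lemma mean_perm_cross_norm (y : R) : 0 < y ->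
  E (fun s => `|U s|) <= (12 * n%:R ^+ 3 * K ^+ 4 / y + y) / 2.
Proof.
move=> y0.
apply: (@le_trans _ _ (E (fun s => (2 * y)^-1 * U s ^+ 2 + y / 2))).
  apply: mean_le => // s; rewrite -[U s ^+ 2]real_normK ?num_real//.
  rewrite -subr_ge0 (_ : _ - _ = (`|U s| - y) ^+ 2 / (2 * y)); last first.
    by field; rewrite gt_eqF.
  by rewrite divr_ge0 ?sqr_ge0// mulr_ge0 ?ltW.
rewrite meanD mean_const// meanZ.
have -> (m : R) : (m / y + y) / 2 = (2 * y)^-1 * m + y / 2.
  by field; rewrite gt_eqF.
rewrite lerD2r.
by rewrite ler_wpM2l ?perm_cross_sq// invr_ge0 mulr_ge0 ?ltW.
Qed.

End Stein.

Lemma is_derive_mean (R : realType) (T : finType) (F dF : T -> R -> R) (x : R) :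
  (forall t, is_derive x 1 (F t) (dF t x)) ->
  is_derive x 1 (fun y => unif_mean (F ^~ y)) (unif_mean (dF ^~ x)).
Proof.
move=> FdF.
have sumF (r : seq T) :
    is_derive x 1 (fun y => \sum_(t <- r) F t y) (\sum_(t <- r) dF t x).
  elim: r => [|t r IH].
    under eq_fun do rewrite big_nil.
    by rewrite big_nil; apply: is_derive_cst.
  under eq_fun do rewrite big_cons.
  by rewrite big_cons; apply: is_deriveD.
have := sumF (index_enum T) => {}sumF.
rewrite /unif_mean; apply: is_derive_eq.
by rewrite scaler0 add0r mulrC.
Qed.

(** With the integrating factor [exp (v t^2 / 2)] the hypothesis bounds a derivative. The mean value
    theorem on [0, 1] gives a point [c], where the remaining factor [exp (v (c^2 - 1) / 2)] is at
    most 1. *)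
Lemma expR_sq_charfun (R : realType) (phi dphi : R -> R) (v e : R) : 0 <= v ->
  (forall t : R, is_derive t 1 phi (dphi t)) ->
  (forall t, 0 <= t <= 1 -> `|dphi t + t * v * phi t| <= e) ->
  `|phi 1 - expR (- (v / 2)) * phi 0| <= e.
Proof.
move=> v0 dphiE phie.
pose psi t := expR (v / 2 * (t * t)) * phi t.
pose dpsi t := expR (v / 2 * (t * t)) * (dphi t + t * v * phi t).
have dpsiE (t : R) : is_derive t 1 psi (dpsi t).
  by rewrite /psi; apply: is_derive_eq; rewrite /dpsi /GRing.scale/=; field.
have [c c01 psiE] : exists2 c, c \in `[0, 1] & psi 1 - psi 0 = dpsi c * (1 - 0).
  apply: (MVT_segment ler01 (fun t _ => dpsiE t)).
  by apply: derivable_within_continuous => t _; apply: ex_derive.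
have {c01} : 0 <= c <= 1 by move: c01; rewrite in_itv.
have -> : phi 1 - expR (- (v / 2)) * phi 0 = expR (- (v / 2)) * (psi 1 - psi 0).
  rewrite /psi !mulr1 !mulr0 expR0 mul1r mulrBr mulrA -expRD addNr expR0.
  by rewrite mul1r.
move=> /[dup] /phie phic /andP[c0 c1].
rewrite psiE subr0 mulr1 /dpsi mulrA -expRD normrM.
rewrite ger0_norm ?expR_ge0// (le_trans _ phic)// ler_piMl//.
rewrite expR_le1 addrC subr_le0 ler_piMr ?divr_ge0// -[leRHS]mulr1.
by rewrite ler_pM.
Qed.

Section CharFun.
Variables (R : realType) (n : nat) (a : 'I_n -> 'I_n -> R) (C : R).
Hypothesis n_gt0 : (0 < n)%N.
Hypothesis a_row : forall i, \sum_c a i c = 0.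
Hypothesis a_col : forall c, \sum_i a i c = 0.
Hypothesis C_ge0 : 0 <= C.
Hypothesis aC : forall i c, `|a i c| <= C / Num.sqrt n%:R.
Local Notation E := (@unif_mean R 'S_n).
Local Notation V := (perm_sum a).
Local Notation U := (perm_cross a).
Local Notation K := (C / Num.sqrt n%:R).

Let n0 : (0 : R) < n%:R. Proof. by rewrite ltr0n. Qed.
Let r0 : 0 < Num.sqrt n%:R :> R. Proof. by rewrite sqrtr_gt0. Qed.
Let rE : n%:R = Num.sqrt n%:R ^+ 2 :> R. Proof. by rewrite sqr_sqrtr ?ltW. Qed.
Let K0 : 0 <= K. Proof. by rewrite divr_ge0 ?sqrtr_ge0. Qed.

Lemma mean_perm_cross_norm_sqrt :
  n%:R^-1 * E (fun s => `|U s|) <= (6 * C ^+ 4 + 1) / Num.sqrt n%:R.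
Proof.
rewrite ler_pdivrMl//.
(* The choice [y = sqrt n] gives both terms order [sqrt n], since [K ^+ 4] is [C ^+ 4 / n ^ 2]. *)
apply: le_trans (mean_perm_cross_norm a_col aC K0 r0) _.
move: rE r0; move: (Num.sqrt n%:R) => r -> r0'.
have -> : (12 * (r ^+ 2) ^+ 3 * (C / r) ^+ 4 / r + r) / 2 =
  (6 * C ^+ 4 + 2^-1) * r by field; rewrite gt_eqF.
have -> : r ^+ 2 * ((6 * C ^+ 4 + 1) / r) = (6 * C ^+ 4 + 1) * r.
  by field; rewrite gt_eqF.
by rewrite ler_wpM2r ?ltW//; lra.
Qed.

Lemma mean_perm_sum_sq_dist :
  `|E (fun s => V s ^+ 2) - n%:R^-1 * sum_sq a| <=
  (6 * C ^+ 4 + 1) / Num.sqrt n%:R.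
Proof.
rewrite (mean_perm_sum_sq a_row a_col aC K0) meanD mean_const//.
rewrite mulrDr addrAC subrr add0r normrM gtr0_norm ?invr_gt0//.
apply: le_trans mean_perm_cross_norm_sqrt.
by rewrite ler_pM2l ?invr_gt0// mean_norm.
Qed.

(* Integrating the Stein identity [phi' t = - t v phi t + O(1/sqrt n)] for
   [phi t = E cos (t V + b)]. *)
Lemma charfun_dist (b : R) :
  `|E (fun s => cos (V s + b)) - expR (- (n%:R^-1 * sum_sq a / 2)) * cos b| <=
  (16 * C ^+ 3 + 6 * C ^+ 4 + 1) / Num.sqrt n%:R.
Proof.
pose phi t := E (fun s => cos (t * V s + b)).
have -> : E (fun s => cos (V s + b)) = phi 1.
  by rewrite /phi; under [in RHS]eq_fun do rewrite mul1r.
have -> : cos b = phi 0.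
  by rewrite /phi; under eq_fun do rewrite mul0r add0r; rewrite mean_const.
apply: (@expR_sq_charfun _ phi (fun t => E (fun s => - (V s * sin (t * V s + b))))).
- rewrite mulr_ge0 ?invr_ge0 ?(ltW n0)//.
  by apply: sumr_ge0 => i _; apply: sumr_ge0 => c _; rewrite sqr_ge0.
- move=> t; apply: (@is_derive_mean _ _ (fun (s : 'S_n) t => cos (t * V s + b))
    (fun s t => - (V s * sin (t * V s + b)))) => s.
  by apply: is_derive_eq; rewrite /GRing.scale/=; ring.
move=> t /andP[t0 t1].
(* The derivative of [phi] is [- E (V * f V)]; the Taylor constant [t ^+ 2] is at most 1 on the
   interval. *)
pose f x := sin (t * x + b); pose f' x := t * cos (t * x + b).
have fL x y : `|f y - f x - (y - x) * f' x| <= t ^+ 2 * (y - x) ^+ 2.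
  have := sin_taylor (t * x + b) (t * y + b).
  by rewrite /f /f' -exprMn; congr (`|_ - _| <= _ ^+ 2); ring.
have := stein a_row a_col aC K0 (sqr_ge0 t) fL.
rewrite meanN /f'.
have -> : E (fun s => t * cos (t * V s + b) * (sum_sq a + U s)) =
    t * sum_sq a * phi t + t * E (fun s => cos (t * V s + b) * U s).
  by rewrite -!meanZ -meanD; congr unif_mean; apply: funext => s; ring.
have cU : n%:R^-1 * `|E (fun s => cos (t * V s + b) * U s)| <=
    (6 * C ^+ 4 + 1) / Num.sqrt n%:R.
  apply: le_trans mean_perm_cross_norm_sqrt; rewrite ler_pM2l ?invr_gt0//.
  rewrite (le_trans (mean_norm _))// mean_le// => s.
  by rewrite normrM ler_piMl// ler_norml cos_geN1 cos_le1.
move: (E (fun s => _ * U s)) cU => u uK.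
move: (E _) => w sw.
have -> : - w + t * (n%:R^-1 * sum_sq a) * phi t =
  - (w - n%:R^-1 * (t * sum_sq a * phi t + t * u)) - t * (n%:R^-1 * u) by ring.
rewrite (le_trans (ler_normB _ _))// normrN.
have -> : (16 * C ^+ 3 + 6 * C ^+ 4 + 1) / Num.sqrt n%:R =
  16 * C ^+ 3 / Num.sqrt n%:R + (6 * C ^+ 4 + 1) / Num.sqrt n%:R by ring.
rewrite lerD//.
  apply: (le_trans sw); move: rE r0; move: (Num.sqrt n%:R) => r -> r0'.
  have -> : 16 * t ^+ 2 * r ^+ 2 * (C / r) ^+ 3 = t ^+ 2 * (16 * C ^+ 3 / r).
    by field; rewrite gt_eqF.
  by rewrite ler_piMl ?exprn_ile1// divr_ge0 ?(ltW r0')// mulr_ge0 ?exprn_ge0.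
rewrite normrM ger0_norm// (le_trans _ uK)// normrM.
by rewrite [X in X * `|u|]gtr0_norm ?invr_gt0// ler_piMl// mulr_ge0 ?invr_ge0 ?ltW.
Qed.

End CharFun.

(** * Riemann sums and covariances *)

(** A Cauchy criterion in which the centre [x] may depend on [e], so no limit has to be
    exhibited. *)
Lemma cvgn_approx (R : realType) (u : R^nat) :
  (forall e, 0 < e -> exists x, \forall n \near \oo, `|x - u n| < e) -> cvgn u.
Proof.
move=> ux; apply/cauchy_cvgP/cauchyP => e e0.
by have [x xe] := ux _ e0; exists x.
Qed.

Section RiemannSums.
Variable R : realType.
Implicit Types (u v : R -> R) (K : R).

Definition lip01 K u := forall x y : R, 0 <= x <= 1 -> 0 <= y <= 1 ->
  `|u x - u y| <= K * `|x - y|.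

(** The left Riemann sum of [u] on [0, 1]. *)
Definition ravg (n : nat) u : R := n%:R^-1 * \sum_(i < n) u (i%:R / n%:R).

Lemma ratio01 n (i : 'I_n) : 0 <= (i%:R / n%:R : R) <= 1.
Proof.
have n0 : (0 < n)%N := leq_ltn_trans (leq0n i) (ltn_ord i).
by rewrite divr_ge0//= ler_pdivrMr ?ltr0n// mul1r ler_nat ltnW.
Qed.

Lemma avg_bound n (F : 'I_n -> R) e : 0 <= e -> (forall i, `|F i| <= e) ->
  `|n%:R^-1 * \sum_i F i| <= e.
Proof.
case: n F => [|n] F e0 Fe; first by rewrite big_ord0 mulr0 normr0.
by rewrite normrM ger0_norm ?invr_ge0// ler_pdivrMl ?ltr0n// sum_bound.
Qed.

Lemma ravg_dist n u v e : 0 <= e ->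
  (forall x, 0 <= x <= 1 -> `|u x - v x| <= e) -> `|ravg n u - ravg n v| <= e.
Proof.
move=> e0 uv; rewrite /ravg -mulrBr -sumrB avg_bound// => i.
by apply: uv; exact: ratio01.
Qed.

Lemma ravg_lip n K (F : R -> R -> R) : 0 <= K ->
  (forall y, 0 <= y <= 1 -> lip01 K (F ^~ y)) -> lip01 K (fun x => ravg n (F x)).
Proof.
move=> K0 FK x y x01 y01; apply: ravg_dist => [|z z01]; first by rewrite mulr_ge0.
exact: FK.
Qed.

(** Each coarse node [i / n] is compared with the [m] fine nodes of its cell, all within [1 / n] of
    it. *)
Lemma ravg_refine n m K u : (0 < n)%N -> (0 < m)%N -> 0 <= K -> lip01 K u ->
  `|ravg n u - ravg (n * m) u| <= K / n%:R.
Proof.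
move=> n0 m0 K0 uK.
have nR : (0 : R) < n%:R by rewrite ltr0n.
have mR : (0 : R) < m%:R by rewrite ltr0n.
have -> : ravg (n * m) u =
    n%:R^-1 * \sum_(i < n) (m%:R^-1 * \sum_(l < m) u ((i * m + l)%:R / (n * m)%:R)).
  rewrite /ravg [X in X^-1 * _ = _]natrM invfM -mulrA -mulr_sumr; congr (_ * (_ * _)).
  rewrite -(big_mkord xpredT (fun i => u (i%:R / (n * m)%:R))) big_nat_mul.
  rewrite big_mkord; apply: eq_bigr => i _.
  rewrite -{1}[(i * m)%N]add0n big_addn mulSn addnK big_mkord.
  by apply: eq_bigr => l _; rewrite addnC.
rewrite /ravg -mulrBr -sumrB avg_bound ?divr_ge0// => i.
have -> : u (i%:R / n%:R) = m%:R^-1 * \sum_(l < m) u (i%:R / n%:R).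
  by rewrite sumr_const card_ord -[X in _ = _ * X]mulr_natl mulKf ?gt_eqF.
rewrite -mulrBr -sumrB avg_bound ?divr_ge0// => l.
have il : (i * m + l < n * m)%N.
  rewrite (@leq_trans (i * m + m))%N ?ltn_add2l//.
  by rewrite -mulSnr leq_mul2r ltn_ord orbT.
have := ratio01 (Ordinal il) => /= il01.
rewrite (le_trans (uK _ _ (ratio01 i) il01))// ler_wpM2l//.
have -> : i%:R / n%:R - (i * m + l)%:R / (n * m)%:R = - (l%:R / m%:R) / n%:R :> R.
  by rewrite natrD !natrM; field; rewrite !gt_eqF.
rewrite normrM normrN !ger0_norm ?invr_ge0// ?divr_ge0// ler_piMl ?invr_ge0//.
by have /andP[] := ratio01 l.
Qed.

Definition ravg3 n (F : R -> R -> R -> R) :=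
  ravg n (fun x => ravg n (fun y => ravg n (F x y))).

Definition lip3 K F := [/\
  forall x y, 0 <= x <= 1 -> 0 <= y <= 1 -> lip01 K (F x y),
  forall x z, 0 <= x <= 1 -> 0 <= z <= 1 -> lip01 K (fun y => F x y z) &
  forall y z, 0 <= y <= 1 -> 0 <= z <= 1 -> lip01 K (fun x => F x y z)].

(** The three variables are refined one at a time, the innermost first, at a cost of [K / n]
    each. *)
Lemma ravg3_refine n m K F : (0 < n)%N -> (0 < m)%N -> 0 <= K -> lip3 K F ->
  `|ravg3 n F - ravg3 (n * m) F| <= 3 * (K / n%:R).
Proof.
move=> n0 m0 K0 [F3 F2 F1]; have Kn : 0 <= K / n%:R by rewrite divr_ge0.
have D1 : `|ravg3 n F - ravg n (fun x => ravg n (fun y => ravg (n * m) (F x y)))|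
    <= K / n%:R.
  do 2!apply: ravg_dist => // ? ?.
  by apply: ravg_refine => //; apply: F3.
have D2 : `|ravg n (fun x => ravg n (fun y => ravg (n * m) (F x y))) -
    ravg n (fun x => ravg (n * m) (fun y => ravg (n * m) (F x y)))| <= K / n%:R.
  apply: ravg_dist => // x x01; apply: ravg_refine => //.
  by apply: ravg_lip => // z z01; apply: F2.
have D3 : `|ravg n (fun x => ravg (n * m) (fun y => ravg (n * m) (F x y))) -
    ravg3 (n * m) F| <= K / n%:R.
  apply: ravg_refine => //.
  by apply: ravg_lip => // y y01; apply: ravg_lip => // z z01; apply: F1.
rewrite (le_trans (ler_distD (ravg n (fun x => ravg n (fun y => ravg (n * m) (F x y)))) _ _))//.
have -> : 3 * (K / n%:R) = K / n%:R + (K / n%:R + K / n%:R) by ring.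
rewrite lerD// (le_trans (ler_distD (ravg n (fun x => ravg (n * m) (fun y => ravg (n * m) (F x y)))) _ _))//.
by rewrite lerD.
Qed.

Lemma cvgn_invn_small (C e : R) : 0 < e -> \forall n \near \oo, C / n%:R < e.
Proof.
move=> e0; exists (Num.bound (`|C| / e)).+1 => // n /= Cn.
have n0 : (0 : R) < n%:R by rewrite ltr0n (leq_trans _ Cn).
rewrite ltr_pdivrMr// (le_lt_trans (ler_norm C))// mulrC -ltr_pdivrMr//.
apply: lt_trans (archi_boundP _) _; first by rewrite divr_ge0 ?(ltW e0).
by rewrite ltr_nat.
Qed.

(** The terms of index [N.+1] and [n] are both compared with the common refinement of index
    [N.+1 * n]. *)
Lemma cvgn_refine (s : R^nat) (D : R) :
  (forall n m, (0 < n)%N -> (0 < m)%N -> `|s n - s (n * m)%N| <= D / n%:R) ->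
  cvgn s.
Proof.
move=> sD; apply: cvgn_approx => e e0.
have [N _ Ne] := cvgn_invn_small D (divr_gt0 e0 (ltr0n R 2)).
exists (s N.+1); exists N.+1 => // n /= Nn.
have n0 : (0 < n)%N by rewrite (leq_trans _ Nn).
rewrite (le_lt_trans (ler_distD (s (N.+1 * n)%N) _ _))//.
rewrite [e]splitr ltrD// ?[X in _ < X]/=.
  by rewrite (le_lt_trans (sD _ _ _ _))// Ne//=.
by rewrite distrC mulnC (le_lt_trans (sD _ _ _ _))// Ne//= ltnW.
Qed.

Lemma cvgn_ravg3 K F : 0 <= K -> lip3 K F -> cvgn (fun n => ravg3 n F).
Proof.
move=> K0 F3; apply: (@cvgn_refine _ (3 * K)) => n m n0 m0.
by rewrite -mulrA (ravg3_refine n0 m0 K0 F3).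
Qed.

End RiemannSums.

Lemma sum_inj_le (R : realType) m n (h : 'I_m -> 'I_n) (F : 'I_n -> R) :
  injective h -> (forall i, 0 <= F i) -> \sum_i F (h i) <= \sum_i F i.
Proof.
move=> hI F0; rewrite -(big_imset _ (in2W hI)) [leRHS](bigID (mem [set h x | x in 'I_m]%SET))/=.
by rewrite lerDl sumr_ge0.
Qed.

(** * Doubly centred arrays *)

Section Centering.
Variables (R : realType) (n : nat).
Hypothesis n_gt0 : (0 < n)%N.
Implicit Types b : 'I_n -> 'I_n -> R.

Definition rmean b i : R := n%:R^-1 * \sum_c b i c.
Definition tmean b : R := n%:R^-1 * \sum_i rmean b i.
(* Meant for symmetric [b]: column means are row means. *)
Definition center b i c : R := b i c - rmean b i - rmean b c + tmean b.

Definition symmetric_fun b := forall i c, b i c = b c i.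

Let n0 : n%:R != 0 :> R. Proof. by rewrite pnatr_eq0 -lt0n. Qed.

Lemma sum_rmean b : \sum_i rmean b i = n%:R * tmean b.
Proof. by rewrite /tmean mulVKf. Qed.

Lemma sum_row b i : \sum_c b i c = n%:R * rmean b i.
Proof. by rewrite /rmean mulVKf. Qed.

Let sum_cst (x : R) : \sum_(i < n) x = n%:R * x.
Proof. by rewrite sumr_const card_ord mulr_natl. Qed.

Lemma center_row b i : \sum_c center b i c = 0.
Proof.
rewrite /center big_split/= !sumrB !sum_cst sum_rmean sum_row; ring.
Qed.

Lemma center_sym b : symmetric_fun b -> symmetric_fun (center b).
Proof. by move=> bS i c; rewrite /center bS; ring. Qed.

Lemma center_col b c : symmetric_fun b -> \sum_i center b i c = 0.
Proof.
by move=> bS; rewrite -[RHS](center_row b c); apply: eq_bigr => i _; rewrite center_sym.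
Qed.

Lemma rmean_bound b i e : 0 <= e -> (forall i c, `|b i c| <= e) -> `|rmean b i| <= e.
Proof. by move=> e0 be; apply: avg_bound. Qed.

Lemma center_bound b i c e : 0 <= e -> (forall i c, `|b i c| <= e) ->
  `|center b i c| <= 4 * e.
Proof.
move=> e0 be.
have -> : 4 * e = e + e + e + e by ring.
rewrite /center (le_trans (ler_normD _ _))// lerD//; last first.
  by apply: avg_bound => // j; exact: rmean_bound.
by rewrite !(le_trans (ler_normB _ _))// !lerD// ?(le_trans (ler_normB _ _))// ?lerD// rmean_bound.
Qed.

Lemma perm_sum_center b (s : 'S_n) :
  perm_sum (center b) s = perm_sum b s - n%:R * tmean b.
Proof.
rewrite /perm_sum /center big_split/= !sumrB sum_cst sum_rmean.
rewrite [\sum_i rmean b (s i)](_ : _ = n%:R * tmean b); first by ring.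
by rewrite -sum_rmean [RHS](reindex_inj (@perm_inj _ s)).
Qed.

Lemma mean_perm_sum b : unif_mean (perm_sum b) = n%:R * tmean b.
Proof.
rewrite /perm_sum mean_sum -sum_rmean; apply: eq_bigr => i _.
rewrite (mean_move (fun c s => b i c)) /rmean; congr (_ * _).
by apply: eq_bigr => c _; rewrite mean_const.
Qed.

(** Arrays constant along rows or columns are orthogonal to a centred array, so the centring of [b]
    is dropped before that of [b'] is expanded. *)
Lemma sum_center_prod b b' : symmetric_fun b -> symmetric_fun b' ->
  \sum_i \sum_c center b i c * center b' i c =
  \sum_i \sum_c b i c * b' i c - 2 * n%:R * (\sum_i rmean b i * rmean b' i)
  + n%:R ^+ 2 * (tmean b * tmean b').
Proof.
move=> bS bS'.
have E1 i : \sum_c center b i c * center b' i c =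
    \sum_c b i c * center b' i c - \sum_c rmean b c * center b' i c.
  transitivity (\sum_c b i c * center b' i c - \sum_c rmean b c * center b' i c
      + (tmean b - rmean b i) * \sum_c center b' i c).
    rewrite mulr_sumr -sumrB -big_split/=; apply: eq_bigr => c _.
    by rewrite {1}/center; ring.
  by rewrite center_row mulr0 addr0.
under eq_bigr do rewrite E1.
rewrite sumrB [X in _ - X]exchange_big/= [X in _ - X]big1 ?subr0; last first.
  by move=> c _; rewrite -mulr_sumr center_col ?mulr0.
have E2 i : \sum_c b i c * center b' i c = \sum_c b i c * b' i c
    - n%:R * (rmean b i * rmean b' i) - \sum_c b i c * rmean b' c
    + n%:R * tmean b' * rmean b i.
  have -> : n%:R * (rmean b i * rmean b' i) = \sum_c b i c * rmean b' i.
    by rewrite -mulr_suml sum_row mulrA.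
  have -> : n%:R * tmean b' * rmean b i = \sum_c b i c * tmean b'.
    by rewrite -mulr_suml sum_row; ring.
  rewrite -!sumrB -big_split/=; apply: eq_bigr => c _.
  by rewrite /center; ring.
under eq_bigr do rewrite E2.
rewrite big_split/= !sumrB -mulr_sumr -[X in _ + X = _]mulr_sumr sum_rmean.
rewrite [\sum_i \sum_c b i c * rmean b' c](_ : _ =
    n%:R * \sum_i rmean b i * rmean b' i); first by ring.
rewrite exchange_big mulr_sumr; apply: eq_bigr => c _.
rewrite -mulr_suml mulrA -sum_row; congr (_ * _).
by apply: eq_bigr => i _; rewrite bS.
Qed.

End Centering.

(** * Limiting covariances of powers of distances *)

Section Covariance.
Variable R : realType.

Definition pdist q (x y : R) : R := `|x - y| ^+ q.
Definition pdist_mx n q (i c : 'I_n) : R := pdist q (i%:R / n%:R) (c%:R / n%:R).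
(** The leading term of the covariance of the two permutation sums of scaled distances, each divided
    by [sqrt n]. *)
Definition cov n q q' : R :=
  n%:R^-2 * \sum_i \sum_c center (@pdist_mx n q) i c * center (@pdist_mx n q') i c.

Lemma dist01 (x y : R) : 0 <= x <= 1 -> 0 <= y <= 1 -> `|x - y| <= 1.
Proof. by move=> /andP[? ?] /andP[? ?]; rewrite ler_norml; apply/andP; split; lra. Qed.

Lemma pdist_bound q (x y : R) : 0 <= x <= 1 -> 0 <= y <= 1 -> `|pdist q x y| <= 1.
Proof. by move=> x01 y01; rewrite ger0_norm ?exprn_ge0// exprn_ile1// dist01. Qed.

Lemma pdist_mx_bound n q (i c : 'I_n) : `|pdist_mx q i c| <= 1.
Proof. by apply: pdist_bound; exact: ratio01. Qed.

Lemma pdistC q (x y : R) : pdist q x y = pdist q y x.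
Proof. by rewrite /pdist distrC. Qed.

Lemma pdist_mx_sym n q : symmetric_fun (@pdist_mx n q).
Proof. by move=> i c; exact: pdistC. Qed.

Lemma lip01M K K' (u v : R -> R) :
  (forall x, 0 <= x <= 1 -> `|u x| <= 1) -> (forall x, 0 <= x <= 1 -> `|v x| <= 1) ->
  lip01 K u -> lip01 K' v -> lip01 (K + K') (fun x => u x * v x).
Proof.
move=> u1 v1 uK vK x y x01 y01.
have -> : u x * v x - u y * v y = (u x - u y) * v x + u y * (v x - v y) by ring.
rewrite (le_trans (ler_normD _ _))// [leRHS]mulrDl !normrM lerD//.
  by rewrite -[leRHS]mulr1 ler_pM ?uK ?v1.
by rewrite -[leRHS]mul1r ler_pM ?vK ?u1.
Qed.

Lemma pdist_lip q (y : R) : 0 <= y <= 1 -> lip01 q%:R (pdist q ^~ y).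
Proof.
move=> y01; elim: q => [|q IH].
  by move=> x z _ _; rewrite /pdist !expr0 subrr normr0 mul0r.
rewrite -natr1 addrC.
have -> : pdist q.+1 ^~ y = fun x => `|x - y| * pdist q x y.
  by apply: funext => x; rewrite /pdist exprS.
apply: lip01M IH => [x x01|x x01|x z _ _].
- by rewrite normr_id dist01.
- exact: pdist_bound.
- by rewrite mul1r (le_trans (ler_dist_dist _ _))// opprB addrA subrK.
Qed.

Lemma pdist_lipr q (y : R) : 0 <= y <= 1 -> lip01 q%:R (pdist q y).
Proof. by move=> y01 x z x01 z01; rewrite !(pdistC _ y) pdist_lip. Qed.

Lemma cst_lip K (c : R) : 0 <= K -> lip01 K (fun=> c).
Proof. by move=> K0 x y _ _; rewrite subrr normr0 mulr_ge0. Qed.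

Lemma cvgn_ravg3_pdist q q' :
  cvgn (fun n => ravg3 n (fun x y z : R => pdist q x y * pdist q' x z)).
Proof.
apply: (@cvgn_ravg3 _ (q%:R + q'%:R)) => //.
split=> x y x01 y01.
- apply: lip01M => [z z01|z z01||]; rewrite ?pdist_bound//.
    exact: cst_lip.
  exact: pdist_lipr.
- apply: lip01M => [z z01|z z01||]; rewrite ?pdist_bound//.
    exact: pdist_lipr.
  exact: cst_lip.
- by apply: lip01M => [z z01|z z01||]; rewrite ?pdist_bound//; exact: pdist_lip.
Qed.

Lemma ravg_cst n (c : R) : (0 < n)%N -> ravg n (fun=> c) = c.
Proof.
move=> n0; rewrite /ravg sumr_const card_ord -[X in _ * X]mulr_natl mulKf//.
by rewrite pnatr_eq0 -lt0n.
Qed.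

Lemma ravg3_pdist n q q' : (0 < n)%N ->
  ravg3 n (fun x y z : R => pdist q x y * pdist q' x z) =
  n%:R^-1 * \sum_(i < n) rmean (pdist_mx q) i * rmean (pdist_mx q') i.
Proof.
move=> n0; rewrite /ravg3 {1}/ravg; congr (_ * _); apply: eq_bigr => i _.
rewrite /ravg /rmean -mulrA; congr (_ * _); rewrite mulr_suml.
apply: eq_bigr => c _; rewrite -mulr_sumr mulrCA; congr (_ * _).
Qed.

(** A factor with exponent 0 is 1, so every term of [sum_center_prod] takes the form of the one
    triple average whose convergence is known. *)
Lemma covE n q q' : (0 < n)%N ->
  cov n q q' = ravg3 n (fun x y z : R => pdist (q + q') x y * pdist 0 x z)
   - 2 * ravg3 n (fun x y z : R => pdist q x y * pdist q' x z)
   + ravg3 n (fun x y z : R => pdist q x y * pdist 0 x z) *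
     ravg3 n (fun x y z : R => pdist q' x y * pdist 0 x z).
Proof.
move=> n0; rewrite !ravg3_pdist//.
have nR : n%:R != 0 :> R by rewrite pnatr_eq0 -lt0n.
have r0 i : rmean (@pdist_mx n 0) i = 1.
  rewrite /rmean /pdist_mx /pdist; under eq_bigr do rewrite expr0.
  exact: ravg_cst n0.
under [X in _ = _ * X - _ + _]eq_bigr do rewrite r0 mulr1.
under [X in _ = _ + _ * X * _]eq_bigr do rewrite r0 mulr1.
under [X in _ = _ + _ * (_ * X)]eq_bigr do rewrite r0 mulr1.
rewrite /cov sum_center_prod//; try exact: pdist_mx_sym.
rewrite [X in _ = X - _ + _](_ : _ =
    n%:R^-2 * \sum_(i < n) \sum_(c < n) pdist_mx q i c * pdist_mx q' i c); last first.
  rewrite exprS expr1 invfM -mulrA; congr (_ * _).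
  rewrite mulr_sumr; apply: eq_bigr => i _; congr (_ * _).
  by apply: eq_bigr => c _; rewrite /pdist_mx /pdist exprD.
by rewrite /tmean; field.
Qed.

Lemma cvgn_cov q q' : cvgn (fun n => cov n q q').
Proof.
have H a b : cvgn (fun n => ravg3 n (fun x y z : R => pdist a x y * pdist b x z)).
  exact: cvgn_ravg3_pdist.
have C : cvgn (fun n => ravg3 n (fun x y z : R => pdist (q + q') x y * pdist 0 x z)
   - 2 * ravg3 n (fun x y z : R => pdist q x y * pdist q' x z)
   + ravg3 n (fun x y z : R => pdist q x y * pdist 0 x z) *
     ravg3 n (fun x y z : R => pdist q' x y * pdist 0 x z)).
  apply: is_cvgD; last by apply: is_cvgM.
  by apply: is_cvgB => //; apply: is_cvgMl_tmp.
apply/cvg_ex; move/cvg_ex : C => [l Cl]; exists l.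
apply: cvg_trans Cl; apply: near_eq_cvg.
by exists 1%N => // n /= n0; rewrite covE.
Qed.

(* A mixed difference [x i c + x i' c' - x i c' - x i' c] kills row and column
   means. Here [i, c] are among the first [m] indices, [i', c'] are their
   translates by [3 m], so that two of the distances are at most [m] and the
   other two at least [2 m]. *)
Lemma cov_ge n q : (3 < n)%N -> (0 < q)%N ->
  (8 ^+ (q + 1))^-2 / 4 <= cov n q q.
Proof.
move=> n4 q0; pose m := (n %/ 4)%N.
have n0 : (0 : R) < n%:R by rewrite ltr0n; lia.
have m0 : (0 < m)%N by rewrite /m; lia.
have h1P (i : 'I_m) : (i < n)%N by rewrite /m in i *; have := ltn_ord i; lia.
have h2P (i : 'I_m) : (3 * m + i < n)%N by rewrite /m in i *; have := ltn_ord i; lia.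
pose h1 i := Ordinal (h1P i); pose h2 i := Ordinal (h2P i).
have h1I : injective h1 by move=> i j /(congr1 val)/= /val_inj.
have h2I : injective h2 by move=> i j /(congr1 val)/= /addnI/val_inj.
pose x := center (@pdist_mx n q).
pose w : R := (m%:R / n%:R) ^+ q.
have w0 : 0 <= w by rewrite exprn_ge0// divr_ge0.
have D i c : w ^+ 2 <= x (h1 i) (h1 c) ^+ 2 + x (h2 i) (h2 c) ^+ 2
                      + x (h1 i) (h2 c) ^+ 2 + x (h2 i) (h1 c) ^+ 2.
  have small (y z : nat) : (y < m)%N -> (z < m)%N -> (`|y%:R - z%:R| / n%:R) ^+ q <= w.
    move=> ym zm; rewrite lerXn2r ?nnegrE ?divr_ge0 ?(ltW n0)//.
    rewrite ler_pM2r ?invr_gt0// ler_norml; apply/andP; split.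
      rewrite lerNl opprB; have : z%:R <= m%:R :> R by rewrite ler_nat ltnW.
      by have : 0 <= y%:R :> R by []; lra.
    have : y%:R <= m%:R :> R by rewrite ler_nat ltnW.
    by have : 0 <= z%:R :> R by []; lra.
  (* Here [0 < q] matters: doubling the distance multiplies its power by [2 ^ q], which is at least
     2. *)
  have large (y : R) : 2 * m%:R <= y -> 2 * w <= (y / n%:R) ^+ q.
    move=> ym; apply: (@le_trans _ _ ((2 * (m%:R / n%:R)) ^+ q)).
      rewrite exprMn ler_wpM2r//.
      by rewrite -natrX ler_nat -{1}(expn1 2) leq_exp2l.
    rewrite lerXn2r ?nnegrE ?mulr_ge0// ?divr_ge0 ?(ltW n0)//.
      by rewrite (le_trans _ ym)// mulr_ge0.
    by rewrite mulrA ler_pM2r ?invr_gt0.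
  have P (i' c' : 'I_n) : pdist_mx q i' c' = (`|i'%:R - c'%:R| / n%:R) ^+ q.
    rewrite /pdist_mx /pdist -mulrBl normrM.
    by rewrite [`|n%:R^-1|]ger0_norm ?invr_ge0 ?ltW.
  have im : i%:R <= m%:R :> R by rewrite ler_nat ltnW.
  have cm : c%:R <= m%:R :> R by rewrite ler_nat ltnW.
  have i0 : 0 <= i%:R :> R by [].
  have c0 : 0 <= c%:R :> R by [].
  have b1 : pdist_mx q (h1 i) (h1 c) <= w by rewrite P /= small.
  have b2 : pdist_mx q (h2 i) (h2 c) <= w.
    by rewrite P /= !natrD opprD addrACA subrr add0r small.
  have b3 : 2 * w <= pdist_mx q (h1 i) (h2 c).
    rewrite P large//= distrC natrD natrM ger0_norm; lra.
  have b4 : 2 * w <= pdist_mx q (h2 i) (h1 c).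
    rewrite P large//= natrD natrM ger0_norm; lra.
  have : x (h1 i) (h1 c) + x (h2 i) (h2 c) - x (h1 i) (h2 c) - x (h2 i) (h1 c)
      <= - (2 * w).
    by rewrite /x /center; lra.
  move: (x (h1 i) (h1 c)) (x (h2 i) (h2 c)) (x (h1 i) (h2 c)) (x (h2 i) (h1 c)) => x1 x2 x3 x4 xw.
  (* The product says that the squared mixed difference is at least [4 w^2]. It is at most four
     times the sum of the four squares, the deficit being a combination of the squares below. *)
  have : 0 <= (- (x1 + x2 - x3 - x4) - 2 * w) * (- (x1 + x2 - x3 - x4) + 2 * w).
    by apply: mulr_ge0; lra.
  have := sqr_ge0 (x1 - x2); have := sqr_ge0 (x3 - x4).
  have := sqr_ge0 (x1 + x2 + x3 + x4); lra.
pose S := \sum_i \sum_c x i c ^+ 2.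
have blk (g h : 'I_m -> 'I_n) : injective g -> injective h ->
    \sum_i \sum_c x (g i) (h c) ^+ 2 <= S.
  move=> gI hI; apply: le_trans (sum_inj_le gI _); last first.
    by move=> i; apply: sumr_ge0 => c _; exact: sqr_ge0.
  apply: ler_sum => i _; apply: (sum_inj_le (F := fun c => x (g i) c ^+ 2)) => // c.
  exact: sqr_ge0.
have mS : m%:R ^+ 2 * w ^+ 2 <= 4 * S.
  have -> : m%:R ^+ 2 * w ^+ 2 = \sum_(i < m) \sum_(c < m) w ^+ 2.
    rewrite !sumr_const !card_ord -[RHS]mulr_natl -[X in _ = _ * X]mulr_natl.
    by rewrite mulrA expr2.
  apply: (@le_trans _ _ (\sum_i \sum_c (x (h1 i) (h1 c) ^+ 2 + x (h2 i) (h2 c) ^+ 2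
                      + x (h1 i) (h2 c) ^+ 2 + x (h2 i) (h1 c) ^+ 2))).
    by apply: ler_sum => i _; apply: ler_sum => c _; exact: D.
  under eq_bigr do rewrite !big_split/=.
  rewrite !big_split/=.
  have := blk _ _ h1I h1I; have := blk _ _ h2I h2I.
  have := blk _ _ h1I h2I; have := blk _ _ h2I h1I; lra.
have -> : cov n q q = n%:R^-2 * S.
  by congr (_ * _); apply: eq_bigr => i _; apply: eq_bigr => c _; rewrite expr2.
apply: (@le_trans _ _ (n%:R^-2 * (m%:R ^+ 2 * w ^+ 2 / 4))); last first.
  by rewrite ler_wpM2l ?invr_ge0 ?exprn_ge0 ?(ltW n0)//; lra.
have -> : n%:R^-2 * (m%:R ^+ 2 * w ^+ 2 / 4) = ((m%:R / n%:R) ^+ (q + 1)) ^+ 2 / 4.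
  by rewrite /w exprD expr1; field; rewrite gt_eqF.
(* The claim is reduced to [1 / 8 <= m / n]: since [m >= 1], [n <= 4 m + 3 <= 8 m]. *)
rewrite ler_wpM2r// -!exprVn -!exprM lerXn2r ?nnegrE ?divr_ge0 ?(ltW n0)//.
rewrite ler_pdivlMr// mulrC ler_pdivrMr// -natrM ler_nat /m; lia.
Qed.

End Covariance.

(** The mean is 1 unless the variance vanishes; then the convention [0^-1 = 0] makes it 0. No lower
    bound on the variance is therefore required. *)
Lemma mean_standardize_sq (R : realType) (T : finType) (F : T -> R) :
  unif_mean (fun t => standardize F t ^+ 2) <= 1.
Proof.
under eq_fun do rewrite exprMn; rewrite meanZ -[X in _ * X]/(unif_var F).
have v0 : 0 <= unif_var F.
  by rewrite /unif_var /unif_mean divr_ge0// sumr_ge0// => t _; exact: sqr_ge0.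
rewrite exprVn sqr_sqrtr//; have [->|v1] := eqVneq (unif_var F) 0.
  by rewrite mulr0.
by rewrite mulVf.
Qed.

Lemma cvgn_sqrt_small (R : realType) (d : R^nat) (D : R) :
  (forall n, (0 < n)%N -> `|d n| <= D / Num.sqrt n%:R) -> d @ \oo --> (0 : R).
Proof.
move=> dD; apply/cvgrPdist_lt => e e0.
have [N _ Ne] := cvgn_invn_small (D ^+ 2) (exprn_gt0 2 e0).
exists N.+1 => // n /= Nn; rewrite sub0r normrN.
have n0 : (0 < n)%N by rewrite (leq_trans _ Nn).
rewrite (le_lt_trans (dD _ n0))//.
have D0 : 0 <= D / Num.sqrt n%:R by rewrite (le_trans _ (dD _ n0)).
rewrite -(@ltr_pXn2r _ 2) ?nnegrE ?(ltW e0)// expr_div_n sqr_sqrtr//.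
exact: Ne (ltnW Nn).
Qed.

Lemma cvgn_sum (R : realType) (I : Type) (r : seq I) (P : pred I)
    (u : I -> R^nat) : (forall i, cvgn (u i)) ->
  cvgn (fun n => \sum_(i <- r | P i) u i n).
Proof.
move=> uc; apply/cvg_ex; exists (\sum_(i <- r | P i) limn (u i)).
by apply: cvg_big => [|i _]; [exact: add_continuous|exact: uc].
Qed.

Lemma cvgnM (R : realType) (u v : R^nat) :
  cvgn u -> cvgn v -> cvgn (fun n => u n * v n).
Proof. by move=> uc vc; apply/cvg_ex; exists (limn u * limn v); exact: cvgM. Qed.

Lemma cvgnD (R : realType) (u v : R^nat) :
  cvgn u -> cvgn v -> cvgn (fun n => u n + v n).
Proof. by move=> uc vc; apply/cvg_ex; exists (limn u + limn v); exact: cvgD. Qed.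

Lemma cvgnMl (R : realType) (c : R) (u : R^nat) :
  cvgn u -> cvgn (fun n => c * u n).
Proof. exact: (cvgnM (is_cvg_cst c)). Qed.

Lemma cvgn_near_dist0 (R : realType) (u v : R^nat) :
  (fun n => u n - v n) @ \oo --> (0 : R) -> cvgn v -> cvgn u.
Proof.
move=> uv vc; have := cvgnD (cvgP _ uv) vc.
by have -> : (fun n => u n - v n + v n) = u by apply: funext => n; rewrite subrK.
Qed.

(** * Standardized power sums of displacements *)

Section StandardizedRho.
Variable R : realType.
Local Notation W n q := (perm_sum (center (@pdist_mx R n q))).

Definition rho_std n q (s : 'S_n) : R := standardize (@rho R n q%:R) s.
(** The reciprocal standard deviation of [W n q / sqrt n]; it stays bounded as [n] grows when [q] is
    positive. *)
Definition rho_scale n q : R :=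
  (Num.sqrt (n%:R^-1 * unif_mean (fun s : 'S_n => W n q s ^+ 2)))^-1.

Lemma displacementE n (s : 'S_n) i :
  (displacement s i)%:R = `|(s i)%:R - i%:R| :> R.
Proof. by rewrite /displacement natr_absz intr_norm rmorphB/= !pmulrn. Qed.

Lemma rhoE n q (s : 'S_n) : (0 < n)%N ->
  rho q%:R s = n%:R ^+ q * perm_sum (@pdist_mx R n q) s.
Proof.
move=> n0; have nR : (0 : R) < n%:R by rewrite ltr0n.
rewrite /rho /perm_sum mulr_sumr; apply: eq_bigr => i _.
rewrite powR_mulrn// displacementE /pdist_mx /pdist -mulrBl normrM exprMn.
rewrite [`|n%:R^-1|]gtr0_norm ?invr_gt0// mulrCA -exprMn mulfV ?gt_eqF//.
by rewrite expr1n mulr1 distrC.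
Qed.

Lemma rho_stdE n q (s : 'S_n) : (0 < n)%N ->
  rho_std q s = rho_scale n q * (W n q s / Num.sqrt n%:R).
Proof.
move=> n0; have nR : (0 : R) < n%:R by rewrite ltr0n.
have cE (t : 'S_n) : rho q%:R t - unif_mean (@rho R n q%:R) = n%:R ^+ q * W n q t.
  rewrite perm_sum_center// rhoE// mulrBr; congr (_ - _).
  have -> : @rho R n q%:R = fun t => n%:R ^+ q * perm_sum (@pdist_mx R n q) t.
    by apply: funext => u; rewrite rhoE.
  by rewrite meanZ mean_perm_sum.
rewrite /rho_std /standardize /unif_var cE; under eq_fun do rewrite cE exprMn.
rewrite meanZ /rho_scale; set w := unif_mean _.
have w0 : 0 <= w.
  by rewrite /w /unif_mean divr_ge0// sumr_ge0// => t _; exact: sqr_ge0.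
rewrite sqrtrM ?exprn_ge0 ?exprn_ge0// sqrtr_sqr ger0_norm ?exprn_ge0//.
move: w w0 => w w0; rewrite sqrtrM ?invr_ge0// sqrtrV//.
(* With zero variance both sides are 0; otherwise the powers of [n] cancel. *)
have [->|w1] := eqVneq (Num.sqrt w) 0; first by rewrite !mulr0 invr0 !mul0r.
by field; rewrite w1 !gt_eqF ?exprn_gt0 ?sqrtr_gt0.
Qed.

Lemma mean_rho_std_sq n q : unif_mean (fun s : 'S_n => rho_std q s ^+ 2) <= 1.
Proof. exact: mean_standardize_sq. Qed.

Lemma center_pdist_bound n q (i c : 'I_n) : `|center (@pdist_mx R n q) i c| <= 4.
Proof.
rewrite -[leRHS]mulr1 center_bound//; last by move=> *; exact: pdist_mx_bound.
Qed.

(** The second moment differs from [cov] by O(1/sqrt n), and [cov] has a positive limit by [cov_ge],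
    at which the inverse square root is continuous. *)
Lemma cvgn_rho_scale q : cvgn (fun n => rho_scale n q.+1).
Proof.
pose m n := n%:R^-1 * unif_mean (fun s : 'S_n => W n q.+1 s ^+ 2).
have mcov : (fun n => m n - cov R n q.+1 q.+1) @ \oo --> (0 : R).
  apply: (@cvgn_sqrt_small _ _ (6 * 4 ^+ 4 + 1)) => n n0.
  have nR : (0 : R) < n%:R by rewrite ltr0n.
  pose a i c := center (@pdist_mx R n q.+1) i c / Num.sqrt n%:R.
  have a_row i : \sum_c a i c = 0 by rewrite -mulr_suml center_row ?mul0r.
  have a_col c : \sum_i a i c = 0.
    by rewrite -mulr_suml center_col ?mul0r//; exact: pdist_mx_sym.
  have aC i c : `|a i c| <= 4 / Num.sqrt n%:R.
    rewrite normrM [X in _ * X]ger0_norm ?invr_ge0// ler_wpM2r ?invr_ge0//.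
    exact: center_pdist_bound.
  have := mean_perm_sum_sq_dist n0 a_row a_col (ler0n R 4) aC.
  congr (`|_ - _| <= _).
    rewrite /m -meanZ; congr unif_mean; apply: funext => s.
    by rewrite /perm_sum -mulr_suml exprMn exprVn sqr_sqrtr// mulrC.
  rewrite /cov exprS expr1 invfM -mulrA; congr (_ * _); rewrite /sum_sq mulr_sumr.
  apply: eq_bigr => i _; rewrite mulr_sumr; apply: eq_bigr => c _.
  by rewrite exprMn exprVn sqr_sqrtr// mulrC expr2.
have := @cvgn_cov R q.+1 q.+1; set l := limn _ => covl.
have l0 : 0 < l.
  apply: (@lt_le_trans _ _ ((8 ^+ (q.+1 + 1))^-2 / 4)).
    by rewrite divr_gt0// invr_gt0 !exprn_gt0.
  by apply: (cvgr_to_ge covl); exists 4%N => // n /= n4; exact: cov_ge.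
have ml : m @ \oo --> l.
  have -> : m = fun n => m n - cov R n q.+1 q.+1 + cov R n q.+1 q.+1.
    by apply: funext => n; rewrite subrK.
  by rewrite -[l]add0r; apply: cvgD mcov covl.
apply/cvg_ex; exists (Num.sqrt l)^-1.
apply: cvgV; first by rewrite gt_eqF ?sqrtr_gt0.
by apply: continuous_cvg ml; exact: sqrt_continuous.
Qed.

Variable k : nat.

Lemma rho_scale_bound : exists2 B : R, 0 <= B &
  forall n (j : 'I_k), `|rho_scale n j.+1| <= B.
Proof.
have bnd (j : 'I_k) : exists B, forall n, `|rho_scale n j.+1| <= B.
  have [B [_ Bb]] := cvg_seq_bounded (@cvgn_rho_scale j).
  by exists (B + 1) => n; apply: Bb; rewrite ?ltrDl.
have [B Bb] := choice bnd.
exists (\sum_j `|B j|) => [|n j]; first exact: sumr_ge0.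
rewrite (le_trans (Bb j n))// (le_trans (ler_norm _))//.
by rewrite (bigD1 j)//= lerDl sumr_ge0.
Qed.

Lemma rho_std_move : exists2 C : R, 0 <= C & forall n (j : 'I_k) i c (s : 'S_n),
  `|rho_std j.+1 (move i c s) - rho_std j.+1 s| <= C / Num.sqrt n%:R.
Proof.
have [B B0 Bb] := rho_scale_bound; exists (16 * B); first by rewrite mulr_ge0.
move=> n j i c s; have n0 : (0 < n)%N := leq_ltn_trans (leq0n i) (ltn_ord i).
rewrite !rho_stdE// -mulrBr -mulrBl !normrM.
rewrite [X in _ * (_ * X)]ger0_norm ?invr_ge0// mulrA ler_wpM2r ?invr_ge0//.
(* One factor 4 bounds the centred entries, the other comes from [perm_sum_move]. *)
have -> : 16 * B = B * (4 * 4) by ring.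
rewrite ler_pM//; apply: perm_sum_move => l d; exact: center_pdist_bound.
Qed.

Definition rho_vec n (s : 'S_n) : 'rV[R]_k := \row_(j < k) rho_std j.+1 s.

(** A linear combination of the coordinates is again a permutation sum over a doubly centred array
    with entries O(1/sqrt n), so [charfun_dist] applies. Its variance parameter is the quadratic
    form [v n], which converges with [rho_scale] and [cov]. *)
Lemma cvgn_charfun_rho (t : 'I_k -> R) (b : R) :
  cvgn (fun n => unif_mean (fun s : 'S_n =>
    cos (\sum_j t j * rho_vec s ord0 j + b))).
Proof.
have [B B0 Bb] := rho_scale_bound.
pose C := \sum_j `|t j| * (B * 4).
have C0 : 0 <= C by apply: sumr_ge0 => j _; rewrite !mulr_ge0.
pose v n := \sum_j \sum_l t j * t l * (rho_scale n j.+1 * rho_scale n l.+1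
                                        * cov R n j.+1 l.+1).
have vl : cvgn v.
  apply: cvgn_sum => j; apply: cvgn_sum => l.
  apply: cvgnMl; apply: cvgnM; last exact: cvgn_cov.
  by apply: cvgnM; exact: cvgn_rho_scale.
have el : cvgn (fun n => expR (- (v n / 2)) * cos b).
  apply: cvgnM; last exact: is_cvg_cst.
  apply/cvg_ex; exists (expR (- (limn v / 2))).
  apply: continuous_cvg; first exact: continuous_expR.
  by apply: cvgN; apply: cvgMr_tmp.
apply: cvgn_near_dist0 el.
apply: (@cvgn_sqrt_small _ _ (16 * C ^+ 3 + 6 * C ^+ 4 + 1)) => n n0.
have nR : (0 : R) < n%:R by rewrite ltr0n.
pose a (i c : 'I_n) := \sum_j t j * (rho_scale n j.+1 *
  (center (@pdist_mx R n j.+1) i c / Num.sqrt n%:R)).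
have a_row i : \sum_c a i c = 0.
  rewrite exchange_big big1// => j _.
  by rewrite -!mulr_sumr -mulr_suml center_row// mul0r !mulr0.
have a_col c : \sum_i a i c = 0.
  rewrite exchange_big big1// => j _.
  rewrite -!mulr_sumr -mulr_suml center_col// ?mul0r ?mulr0//.
  exact: pdist_mx_sym.
have aC i c : `|a i c| <= C / Num.sqrt n%:R.
  rewrite (le_trans (ler_norm_sum _ _ _))// mulr_suml ler_sum// => j _.
  rewrite !normrM -!mulrA ler_wpM2l// ler_pM ?mulr_ge0//.
  rewrite [X in _ * X]ger0_norm ?invr_ge0// ler_wpM2r ?invr_ge0//.
  exact: center_pdist_bound.
have := charfun_dist n0 a_row a_col C0 aC b.
have -> : (fun s : 'S_n => cos (perm_sum a s + b)) =
    (fun s : 'S_n => cos (\sum_j t j * rho_vec s ord0 j + b)).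
  apply: funext => s; congr (cos (_ + _)); rewrite /perm_sum /a exchange_big/=.
  apply: eq_bigr => j _; rewrite mxE rho_stdE// -!mulr_sumr.
  by rewrite /perm_sum mulr_suml.
suff -> : n%:R^-1 * sum_sq a = v n by [].
rewrite /v /sum_sq mulr_sumr.
transitivity (\sum_i \sum_c \sum_j \sum_l t j * t l * (rho_scale n j.+1 * rho_scale n l.+1
   * (n%:R^-2 * (center (@pdist_mx R n j.+1) i c * center (@pdist_mx R n l.+1) i c)))).
  apply: eq_bigr => i _; rewrite mulr_sumr; apply: eq_bigr => c _.
  rewrite expr2 /a mulr_suml mulr_sumr; apply: eq_bigr => j _.
  rewrite !mulr_sumr; apply: eq_bigr => l _.
  have -> : n%:R^-2 = n%:R^-1 * (Num.sqrt n%:R)^-1 ^+ 2 :> R.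
    by rewrite exprVn sqr_sqrtr// -invfM.
  by ring.
under eq_bigr do rewrite exchange_big/=.
rewrite exchange_big/=; apply: eq_bigr => j _.
under eq_bigr do rewrite exchange_big/=.
rewrite exchange_big/=; apply: eq_bigr => l _.
rewrite /cov !mulr_sumr; apply: eq_bigr => i _.
by rewrite !mulr_sumr.
Qed.

End StandardizedRho.

(** * From characteristic functions to weak convergence *)

(** Only [x] is confined to [K]; [y] may leave it. This one-sided form lets a bounded point be
    compared with an arbitrary perturbation. *)
Lemma compact_unif_continuous (R : realType) (T : pseudoMetricType R)
    (K : set T) (g : T -> R) (e : R) : compact K -> continuous g -> 0 < e ->
  exists2 d : R, 0 < d & forall x y, K x -> ball x d y -> `|g x - g y| < e.
Proof.
move=> cK cg e0.
pose P (d : R) x := forall y, ball x d y -> `|g x - g y| < e.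
have /compact_near_coveringP cover := cK.
have : \forall d \near (0 : R)^'+, K `<=` P d.
  apply: cover => x Kx.
  have e2 : 0 < e / 2 by rewrite divr_gt0.
  have /cvgrPdist_lt/(_ _ e2)/nbhs_ballP[r /= r0 rg] := cg x.
  have r2 : 0 < r / 2 by rewrite divr_gt0.
  exists (ball x (r / 2), [set d | 0 < d < r / 2]).
    split => /=; first exact: nbhsx_ballx.
    apply: filterS2 (nbhs_right_gt (0 : R)) (nbhs_right_lt r2) => d d0 dr.
    exact/andP.
  move=> [x' d] /= [xx' /andP[d0 dr]] y x'y.
  rewrite (splitr e) (le_lt_trans (ler_distD (g x) _ _))// ltrD//.
    rewrite distrC; have xrx' : ball x r x'.
      by apply: (@le_ball _ _ _ (r / 2)) xx'; rewrite ler_pdivrMr// ler_peMr ?ler1n// ltW.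
    exact: (rg _ xrx').
  have xry : ball x r y.
    rewrite (splitr r); apply: ball_triangle xx' _.
    by apply: (@le_ball _ _ _ d) x'y; exact: ltW.
  exact: (rg _ xry).
move=> [d /= d0 dP]; exists (d / 2); first by rewrite divr_gt0.
move=> x y Kx xy; apply: (dP (d / 2)) => //=; rewrite ?divr_gt0//.
by rewrite sub0r normrN gtr0_norm ?divr_gt0// ltr_pdivrMr// ltr_pMr// ltr1n.
Qed.

Lemma unif_continuous_box (R : realType) k (g : 'rV[R]_k -> R) (M e : R) :
  continuous g -> 0 < e ->
  exists2 d : R, 0 < d & forall x y : 'rV[R]_k,
    (forall j, `|x ord0 j| <= M) -> (forall j, `|x ord0 j - y ord0 j| < d) ->
    `|g x - g y| < e.
Proof.
move=> cg e0.
have cK := @rV_compact R k (fun=> `[-M, M]%classic)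
  (fun=> @segment_compact R (-M) M).
have [d d0 dg] := compact_unif_continuous cK cg e0.
exists d => // x y xM xy; apply: dg => [j|]; first by rewrite /= in_itv/= -ler_norml.
by split=> // i j; rewrite (ord1 i); exact: xy.
Qed.

(** By monotonicity of sine on [-pi/2, pi/2] it suffices to move from [a] by exactly [d]. Along the
    way the argument stays within 3/4 of 0, where [cos c >= 1 - |c| >= 1 / 4]. *)
Lemma sin_dist_ge (R : realType) (a b d : R) : 0 <= d <= 1 / 4 ->
  `|a| <= 1 / 2 -> `|b| <= pi / 2 -> d <= `|a - b| -> d / 4 <= `|sin a - sin b|.
Proof.
move=> /andP[d0 d4].
wlog ab : a b / a <= b => [H aM bM dab|].
  case: (leP a b) => [ab|/ltW ba]; first exact: H.
  have := H (- a) (- b); rewrite lerN2 !normrN !sinN => /(_ ba aM bM).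
  by rewrite -!opprD !normrN; apply.
rewrite !ler_norml => /andP[a1 a2] /andP[b1 b2].
rewrite distrC ger0_norm ?subr_ge0// => dab.
have pi2 : 1 <= pi / 2 :> R := pihalf_ge1 R.
have sab : sin (a + d) <= sin b.
  have [->//|abd] := eqVneq (a + d) b.
  rewrite ltW// ltr_sin ?in_itv/=; first by rewrite lt_neqAle abd/=; lra.
    by apply/andP; split; lra.
  by apply/andP; split; lra.
rewrite distrC; apply: le_trans (ler_norm _).
apply: (@le_trans _ _ (sin (a + d) - sin a)); last by lra.
have [c cad ->] : exists2 c, c \in `[a, a + d] & sin (a + d) - sin a = cos c * (a + d - a).
  apply: MVT_segment; first by lra.
  by apply: continuous_subspaceT => z; apply: continuous_sin.
move: cad; rewrite in_itv/= => /andP[c1 c2].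
have : `|cos c - cos 0| <= `|c - 0| := cos_lipschitz 0 c.
rewrite cos0 subr0 ler_norml => /andP[cc _].
have c34 : `|c| <= 3 / 4 by rewrite ler_norml; apply/andP; split; lra.
have : 1 / 4 <= cos c by lra.
by move=> c4; rewrite addrAC subrr add0r; nra.
Qed.

(** * Bernstein polynomials through independent bits *)

Section Bernstein.
Variables (R : realType) (I : finType) (p : I -> R).
Hypothesis p01 : forall c, 0 <= p c <= 1.

(** The law of independent bits, bit [c] being true with probability [p c]. *)
Definition bit_weight (w : {ffun I -> bool}) : R :=
  \prod_c (if w c then p c else 1 - p c).

Lemma bit_weight_ge0 w : 0 <= bit_weight w.
Proof.
by apply: prodr_ge0 => c _; have /andP[? ?] := p01 c; case: ifP; lra.
Qed.

Lemma sum_bit_weight_prod (F : I -> bool -> R) :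
  \sum_w bit_weight w * \prod_c F c (w c) =
  \prod_c (p c * F c true + (1 - p c) * F c false).
Proof.
transitivity (\sum_(w : {ffun I -> bool})
    \prod_c ((if w c then p c else 1 - p c) * F c (w c))).
  by apply: eq_bigr => w _; rewrite big_split.
rewrite -(bigA_distr_bigA (fun c b => (if b then p c else 1 - p c) * F c b)).
by apply: eq_bigr => c _; rewrite big_bool.
Qed.

Lemma sum_bit_weight : \sum_w bit_weight w = 1.
Proof.
transitivity (\sum_w bit_weight w * \prod_(c : I) 1).
  by apply: eq_bigr => w _; rewrite big1_eq mulr1.
rewrite (sum_bit_weight_prod (fun _ _ => 1)) big1// => c _.
by rewrite !mulr1 addrC subrK.
Qed.

Lemma bit_weight_cov c d : c != d ->
  \sum_w bit_weight w * (((w c)%:R - p c) * ((w d)%:R - p d)) = 0.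
Proof.
move=> cd.
pose F e (b : bool) := (if e == c then b%:R - p e else 1) * (if e == d then b%:R - p e else 1).
have FE (w : {ffun I -> bool}) : \prod_e F e (w e) = ((w c)%:R - p c) * ((w d)%:R - p d).
  by rewrite big_split/= -!big_mkcond/= !big_pred1_eq.
under eq_bigr do rewrite -FE.
rewrite sum_bit_weight_prod (bigD1 c)//= /F eqxx (negPf cd) /=.
by rewrite [X in X * _](_ : _ = 0) ?mul0r//; ring.
Qed.

(** Cross terms vanish by independence, and each diagonal term is at most 1. *)
Lemma bit_weight_sq (A : {set I}) (q : R) : (forall c, c \in A -> p c = q) ->
  \sum_w bit_weight w * (\sum_(c in A) ((w c)%:R - q)) ^+ 2 <= #|A|%:R.
Proof.
move=> pq.
have -> : \sum_w bit_weight w * (\sum_(c in A) ((w c)%:R - q)) ^+ 2 =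
    \sum_(c in A) \sum_w bit_weight w * ((w c)%:R - p c) ^+ 2.
  transitivity (\sum_(c in A) \sum_(d in A)
      \sum_w bit_weight w * (((w c)%:R - p c) * ((w d)%:R - p d))).
    under [RHS]eq_bigr do rewrite exchange_big/=.
    rewrite exchange_big/=; apply: eq_bigr => w _.
    rewrite expr2 mulr_suml mulr_sumr; apply: eq_bigr => c cA.
    by rewrite !mulr_sumr; apply: eq_bigr => d dA; rewrite !pq.
  apply: eq_bigr => c cA; rewrite (bigD1 c)//= [X in _ + X]big1 ?addr0//.
  by move=> d /andP[_ dc]; rewrite bit_weight_cov// eq_sym.
rewrite -sum1_card natr_sum ler_sum// => c _.
rewrite -[leRHS]sum_bit_weight ler_sum// => w _.
rewrite ler_piMr ?bit_weight_ge0//.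
have /andP[? ?] := p01 c.
have : `|(w c)%:R - p c| <= 1.
  by rewrite ler_norml; case: (w c); rewrite ?mulr1n ?mulr0n; apply/andP; split; lra.
by move=> wc1; rewrite -real_normK ?num_real// exprn_ile1.
Qed.

End Bernstein.

(** A sine gives a probability for every real argument and keeps the approximant trigonometric. The
    scale [2 * M] places the box [|x_j| <= M] in [-1/2, 1/2], as [sin_dist_ge] demands. *)
Definition sin_prob (R : realType) k (M : R) (x : 'rV[R]_k) (j : 'I_k) : R :=
  (1 + sin (x ord0 j / (2 * M))) / 2.

Lemma sin_prob01 (R : realType) k (M : R) (x : 'rV[R]_k) j :
  0 <= sin_prob M x j <= 1.
Proof.
have := sin_geN1 (x ord0 j / (2 * M)); have := sin_le1 (x ord0 j / (2 * M)).
by rewrite /sin_prob => *; apply/andP; split; lra.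
Qed.

(** A Bernstein polynomial as an expectation: coordinate [j] receives [N] independent bits of
    parameter [sin_prob M x j], and [v] is evaluated at the outcome. *)
Definition bernstein_sin (R : realType) k (N : nat) (M : R)
    (v : {ffun 'I_k * 'I_N -> bool} -> R) (x : 'rV[R]_k) : R :=
  \sum_w bit_weight (fun c => sin_prob M x c.1) w * v w.

Section BernsteinApprox.
Variables (R : realType) (k : nat) (g : 'rV[R]_k -> R) (B : R).
Hypothesis g_cont : continuous g.
Hypothesis gB : forall x, `|g x| <= B.

Lemma bernstein_sin_bound N (M : R) (y : {ffun 'I_k * 'I_N -> bool} -> 'rV[R]_k) x :
  `|bernstein_sin M (g \o y) x| <= B.
Proof.
have p01 (c : 'I_k * 'I_N) : 0 <= sin_prob M x c.1 <= 1 := sin_prob01 M x c.1.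
rewrite -[leRHS]mul1r -(sum_bit_weight (fun c : 'I_k * 'I_N => sin_prob M x c.1)) mulr_suml.
rewrite (le_trans (ler_norm_sum _ _ _))// ler_sum// => w _.
by rewrite normrM ger0_norm ?(bit_weight_ge0 p01)// ler_wpM2l ?(bit_weight_ge0 p01)//=.
Qed.

(** Bernstein's argument: [y] recovers a point from the bit frequencies by arcsine. By Chebyshev's
    inequality the recovered point is close to [x] with high probability. *)
Lemma bernstein_sin_approx (M e : R) : 0 < M -> 0 < e ->
  exists N (y : {ffun 'I_k * 'I_N -> bool} -> 'rV[R]_k),
  forall x : 'rV[R]_k, (forall j, `|x ord0 j| <= M) -> `|g x - bernstein_sin M (g \o y) x| <= e.
Proof.
move=> M0 e0; have e2 : 0 < e / 2 by rewrite divr_gt0.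
have B0 : 0 <= B := le_trans (normr_ge0 _) (gB 0).
have L0 : 0 < 2 * M by rewrite mulr_gt0.
have [dl dl0 gdl] := unif_continuous_box M g_cont e2.
pose d := Num.min (dl / (2 * M)) (1 / 4).
have d0 : 0 < d by rewrite lt_min !divr_gt0.
have d4 : 0 <= d <= 1 / 4 by rewrite ltW//= ge_min lexx orbT.
pose h := d / 4; have h0 : 0 < h by rewrite divr_gt0.
(* [N] makes the Chebyshev term [(2 B / h^2) * k * (4 / N)] smaller than [e / 2]. *)
have [N0 _ /(_ N0.+1 (leqnSn _)) NC] := cvgn_invn_small (8 * B * k%:R / h ^+ 2) e2.
pose N := N0.+1; rewrite -/N in NC.
have NR : 0 < N%:R :> R by rewrite ltr0n.
pose A j : {set 'I_k * 'I_N} := [set c | c.1 == j]%SET.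
have cardA j : #|A j| = N.
  have -> : A j = finset.setX [set j]%SET [set: 'I_N]%SET.
    by apply/setP => -[a b]; rewrite !inE/= andbT.
  by rewrite cardsX cards1 cardsT card_ord mul1n.
(* The frequency of true bits in row [j], rescaled to [-1, 1], estimates [sin (a j)]. *)
pose u (w : {ffun 'I_k * 'I_N -> bool}) j : R := 2 * (\sum_(c in A j) (w c)%:R) / N%:R - 1.
have u1 w j : -1 <= u w j <= 1.
  have s0 : 0 <= \sum_(c in A j) (w c)%:R :> R by apply: sumr_ge0.
  have s1 : \sum_(c in A j) (w c)%:R <= N%:R :> R.
    have -> : N%:R = \sum_(c in A j) 1 :> R by rewrite sumr_const cardA.
    rewrite ler_sum// => c _.
    by rewrite lern1; case: (w c).
  have : 0 <= (\sum_(c in A j) (w c)%:R) / N%:R :> R by rewrite divr_ge0.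
  have : (\sum_(c in A j) (w c)%:R) / N%:R <= 1 :> R by rewrite ler_pdivrMr// mul1r.
  by rewrite /u -mulrA => *; apply/andP; split; lra.
pose y w : 'rV[R]_k := \row_j (2 * M * asin (u w j)).
exists N, y => x xM.
pose a j := x ord0 j / (2 * M).
have aj j : `|a j| <= 1 / 2.
  rewrite /a normrM [X in _ * X]ger0_norm ?invr_ge0 ?(ltW L0)//.
  by rewrite ler_pdivrMr// mulrA div1r mulVf ?mul1r// pnatr_eq0.
have p01 (c : 'I_k * 'I_N) : 0 <= sin_prob M x c.1 <= 1 := sin_prob01 M x c.1.
pose W := bit_weight (fun c : 'I_k * 'I_N => sin_prob M x c.1).
(* If all estimates are within [h], uniform continuity gives [e / 2]; otherwise the second term
   exceeds the trivial bound [2 * B]. *)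
have pt w : `|g x - g (y w)| <= e / 2 + 2 * B / h ^+ 2 * \sum_j (u w j - sin (a j)) ^+ 2.
  have [|] := boolP [forall j, `|u w j - sin (a j)| < h].
    move=> /forallP near; rewrite -[leLHS]addr0 lerD//; last first.
      by rewrite !mulr_ge0 ?invr_ge0 ?exprn_ge0 ?(ltW h0)// sumr_ge0// => j _; exact: sqr_ge0.
    apply/ltW/gdl => // j; rewrite mxE.
    have -> : x ord0 j - 2 * M * asin (u w j) = 2 * M * (a j - asin (u w j)).
      by rewrite /a; field; rewrite gt_eqF.
    rewrite normrM (gtr0_norm L0) mulrC -ltr_pdivlMr// (@lt_le_trans _ _ d)//; last first.
      by rewrite ge_min lexx.
    rewrite ltNge; apply/negP => dab.
    have asinB : `|asin (u w j)| <= pi / 2.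
      by rewrite ler_norml asin_geNpi2 ?asin_lepi2.
    have := sin_dist_ge d4 (aj j) asinB dab.
    rewrite asinK ?in_itv/= ?u1// distrC leNgt => /negP; apply; exact: near.
  rewrite negb_forall => /existsP[j]; rewrite -leNgt => hj.
  have hsq : h ^+ 2 <= \sum_j (u w j - sin (a j)) ^+ 2.
    rewrite (bigD1 j)//= -[leLHS]addr0 lerD//; last first.
      by apply: sumr_ge0 => l _; exact: sqr_ge0.
    by rewrite -[leRHS]real_normK ?num_real// lerXn2r ?nnegrE ?(ltW h0).
  have : 2 * B <= 2 * B / h ^+ 2 * \sum_j (u w j - sin (a j)) ^+ 2.
    rewrite -mulrA ler_peMr ?mulr_ge0// mulrC ler_pdivlMr ?exprn_gt0//.
    by rewrite mul1r.
  have := ler_normB (g x) (g (y w)); have := gB x; have := gB (y w); lra.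
rewrite /bernstein_sin -/W.
have -> : g x - \sum_w W w * (g \o y) w = \sum_w W w * (g x - g (y w)).
  under [RHS]eq_bigr do rewrite mulrBr.
  by rewrite sumrB -mulr_suml sum_bit_weight mul1r.
apply: (@le_trans _ _ (\sum_w W w *
    (e / 2 + 2 * B / h ^+ 2 * \sum_j (u w j - sin (a j)) ^+ 2))).
  rewrite (le_trans (ler_norm_sum _ _ _))// ler_sum// => w _.
  by rewrite normrM ger0_norm ?(bit_weight_ge0 p01)// ler_wpM2l ?(bit_weight_ge0 p01).
under eq_bigr do rewrite mulrDr.
rewrite big_split/= -mulr_suml sum_bit_weight mul1r.
have -> : \sum_w W w * (2 * B / h ^+ 2 * \sum_j (u w j - sin (a j)) ^+ 2) =
    2 * B / h ^+ 2 * \sum_j \sum_w W w * (u w j - sin (a j)) ^+ 2.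
  rewrite exchange_big mulr_sumr; apply: eq_bigr => w _.
  by rewrite -mulr_sumr mulrCA.
have var j : \sum_w W w * (u w j - sin (a j)) ^+ 2 <= 4 / N%:R.
  pose q := sin_prob M x j.
  have pq (c : 'I_k * 'I_N) : c \in A j -> sin_prob M x c.1 = q by rewrite inE => /eqP ->.
  have := bit_weight_sq p01 pq; rewrite cardA => V.
  have -> : \sum_w W w * (u w j - sin (a j)) ^+ 2 =
      4 / N%:R ^+ 2 * \sum_w W w * (\sum_(c in A j) ((w c)%:R - q)) ^+ 2.
    rewrite mulr_sumr; apply: eq_bigr => w _.
    rewrite sumrB sumr_const cardA -[q *+ N]mulr_natl /q /sin_prob -/(a j) /u.
    by field; rewrite gt_eqF.
  apply: (@le_trans _ _ (4 / N%:R ^+ 2 * N%:R)).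
    by rewrite ler_wpM2l// divr_ge0 ?exprn_ge0 ?(ltW NR).
  by rewrite expr2 invfM mulrA mulfVK ?gt_eqF.
rewrite [leRHS]splitr lerD2l.
apply: (@le_trans _ _ (2 * B / h ^+ 2 * \sum_(j < k) 4 / N%:R)).
  rewrite ler_wpM2l ?ler_sum// !mulr_ge0 ?invr_ge0 ?exprn_ge0 ?(ltW h0)//.
rewrite sumr_const card_ord -[X in _ * X <= _]mulr_natl; apply: le_trans (ltW NC).
by rewrite le_eqVlt; apply/orP; left; apply/eqP; ring.
Qed.

End BernsteinApprox.

Lemma eq_cvgn (R : realType) (u v : R^nat) :
  cvgn u -> (forall n, u n = v n) -> cvgn v.
Proof. by move=> uc /funext <-. Qed.

(** * Extension to bounded continuous test functions *)

Section WeakLimit.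
Variables (R : realType) (k : nat) (T : nat -> finType).
Variable Y : forall n, T n -> 'rV[R]_k.
Hypothesis T_gt0 : forall n, (0 < #|T n|)%N.
Hypothesis Y_charfun : forall (t : 'I_k -> R) (b : R),
  cvgn (fun n => unif_mean (fun s : T n => cos (\sum_j t j * Y s ord0 j + b))).
Hypothesis Y_sq : forall n j, unif_mean (fun s : T n => Y s ord0 j ^+ 2) <= 1.

(** Demanding convergence against every cosine makes the class stable under multiplication by
    cosines, so it contains the products that form [bit_weight]. *)
Let cvg_cos (h : 'rV[R]_k -> R) := forall (t : 'I_k -> R) (b : R),
  cvgn (fun n => unif_mean (fun s : T n =>
    h (Y s) * cos (\sum_j t j * Y s ord0 j + b))).

Let cvg_cos1 : cvg_cos (fun=> 1).
Proof.
move=> t b; apply: eq_cvgn (@Y_charfun t b) _ => n.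
by congr unif_mean; apply: funext => s; rewrite mul1r.
Qed.

Let cvg_cosD h h' : cvg_cos h -> cvg_cos h' -> cvg_cos (fun x => h x + h' x).
Proof.
move=> hc hc' t b; apply: eq_cvgn (cvgnD (hc t b) (hc' t b)) _ => n; rewrite -meanD; congr unif_mean.
by apply: funext => s; rewrite mulrDl.
Qed.

Let cvg_cosZ c h : cvg_cos h -> cvg_cos (fun x => c * h x).
Proof.
move=> hc t b; apply: eq_cvgn (@cvgnMl _ c _ (hc t b)) _ => n; rewrite -meanZ; congr unif_mean.
by apply: funext => s; rewrite mulrA.
Qed.

Let cvg_cos_sum (J : Type) (r : seq J) (h : J -> 'rV[R]_k -> R) :
  (forall i, cvg_cos (h i)) -> cvg_cos (fun x => \sum_(i <- r) h i x).
Proof.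
move=> hc; elim: r => [|i r IH].
  move=> t b; apply: (@eq_cvgn _ (cst 0)) => [|n]; first exact: is_cvg_cst.
  by under eq_fun do rewrite big_nil mul0r; rewrite mean_const.
under eq_fun do rewrite big_cons.
exact: cvg_cosD (hc i) IH.
Qed.

(** The product of two cosines is half the sum of the cosines of the sum and of the difference. *)
Let cvg_cosM h (t : 'I_k -> R) (b : R) : cvg_cos h ->
  cvg_cos (fun x => h x * cos (\sum_j t j * x ord0 j + b)).
Proof.
move=> hc t' b'.
apply: eq_cvgn (@cvgnMl _ (1 / 2) _ (cvgnD (hc (fun j => t j + t' j) (b + b'))
                              (hc (fun j => t j - t' j) (b - b')))) _ => n.
rewrite -meanD -meanZ; congr unif_mean.
apply: funext => s.
under eq_bigr do rewrite mulrDl.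
under [X in _ * (_ + _ * cos (X + _)) = _]eq_bigr do rewrite mulrBl.
rewrite big_split/= sumrB.
set u := \sum_j t j * _; set u' := \sum_j t' j * _.
have -> : u + u' + (b + b') = (u + b) + (u' + b') by ring.
have -> : u - u' + (b - b') = (u + b) - (u' + b') by ring.
by rewrite cosD cosB; field.
Qed.

Let cvg_cos_sin_prob M j h : cvg_cos h ->
  cvg_cos (fun x => h x * sin_prob M x j) /\ cvg_cos (fun x => h x * (1 - sin_prob M x j)).
Proof.
move=> hc; pose t l : R := (l == j)%:R / (2 * M).
have sinE (x : 'rV[R]_k) : sin (x ord0 j / (2 * M)) = cos (\sum_l t l * x ord0 l + - (pi / 2)).
  rewrite (bigD1 j)//= big1 ?addr0; last first.
    by move=> l /negPf lj; rewrite /t lj !mul0r.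
  by rewrite /t eqxx mul1r cosB cos_pihalf sin_pihalf mulr0 add0r mulr1 mulrC.
have hs := @cvg_cosM h t (- (pi / 2)) hc.
split.
  have := cvg_cosD (@cvg_cosZ (1 / 2) _ hc) (@cvg_cosZ (1 / 2) _ hs).
  by congr cvg_cos; apply: funext => x; rewrite /sin_prob sinE; field.
have := cvg_cosD (@cvg_cosZ (1 / 2) _ hc) (@cvg_cosZ (- (1 / 2)) _ hs).
by congr cvg_cos; apply: funext => x; rewrite /sin_prob sinE; field.
Qed.

Let cvg_cos_bernstein N M (v : {ffun 'I_k * 'I_N -> bool} -> R) :
  cvg_cos (bernstein_sin M v).
Proof.
apply: (@cvg_cos_sum _ (index_enum _)
  (fun w x => bit_weight (fun c => sin_prob M x c.1) w * v w)) => w.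
under eq_fun do rewrite mulrC.
apply: (@cvg_cosZ (v w) (fun x => bit_weight (fun c => sin_prob M x c.1) w)).
rewrite /bit_weight; elim: (index_enum _) => [|c r IH].
  under eq_fun do rewrite big_nil.
  exact: cvg_cos1.
under eq_fun do rewrite big_cons mulrC.
have [H1 H2] := cvg_cos_sin_prob M c.1 IH.
by case: (w c).
Qed.

(** The averaged sum is at least 1 whenever [Y] leaves the box of radius [M], so this controls the
    probability of leaving it. *)
Lemma tail_bound (M : R) n : 0 < M ->
  unif_mean (fun s : T n => \sum_j (Y s ord0 j ^+ 2 / M ^+ 2)) <= k%:R / M ^+ 2.
Proof.
move=> M0; rewrite mean_sum.
have -> : k%:R / M ^+ 2 = \sum_(j < k) 1 / M ^+ 2.
  by rewrite sumr_const card_ord -[RHS]mulr_natl mulrA mulr1.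
apply: ler_sum => j _; under eq_fun do rewrite mulrC.
rewrite meanZ mulrC ler_wpM2r// invr_ge0 exprn_ge0 ?ltW//.
Qed.

(** Inside a box of radius [M], [g] is replaced by a Bernstein polynomial whose means converge.
    Outside, the error is at most [2 * B] and the tail bound applies; since [M >= 1], making
    [2 * B * k / M] small suffices. *)
Lemma weak_limit (g : 'rV[R]_k -> R) (B : R) : continuous g ->
  (forall x, `|g x| <= B) -> cvgn (fun n => unif_mean (fun s : T n => g (Y s))).
Proof.
move=> cg gB; apply: cvgn_approx => e e0.
have B0 : 0 <= B := le_trans (normr_ge0 _) (gB 0).
have e3 : 0 < e / 3 by rewrite divr_gt0.
have [m _ /(_ m.+1 (leqnSn _)) mC] := cvgn_invn_small (2 * B * k%:R) e3.
pose M : R := m.+1%:R; have M1 : 1 <= M by rewrite ler1n.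
have M0 : 0 < M by rewrite (lt_le_trans _ M1).
have [N [y gy]] := bernstein_sin_approx cg gB M0 e3.
pose P := bernstein_sin M (g \o y).
have Pc : cvgn (fun n => unif_mean (fun s : T n => P (Y s))).
  apply: eq_cvgn (@cvg_cos_bernstein N M (g \o y) (fun=> 0) 0) _ => n; congr unif_mean; apply: funext => s.
  by rewrite big1 => [|j _]; rewrite ?mul0r// addr0 cos0 mulr1.
exists (limn (fun n => unif_mean (fun s : T n => P (Y s)))).
have /cvgrPdist_lt/(_ _ e3)[n0 _ nP] := Pc.
exists n0 => // n /nP /= {}nP.
rewrite (le_lt_trans (ler_distD (unif_mean (fun s : T n => P (Y s))) _ _))//.
have -> : e = e / 3 + (e / 3 + e / 3) by field.
rewrite ltr_leD// distrC.
have D (s : T n) : `|g (Y s) - P (Y s)| <=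
    e / 3 + 2 * B * \sum_j (Y s ord0 j ^+ 2 / M ^+ 2).
  have S0 : 0 <= \sum_j (Y s ord0 j ^+ 2 / M ^+ 2).
    by apply: sumr_ge0 => j _; rewrite divr_ge0 ?sqr_ge0.
  have [/forallP YM|] := boolP [forall j, `|Y s ord0 j| <= M].
    by rewrite -[leLHS]addr0 lerD ?gy// mulr_ge0 ?mulr_ge0.
  rewrite negb_forall => /existsP[j]; rewrite -ltNge => Mj.
  have S1 : 1 <= \sum_j (Y s ord0 j ^+ 2 / M ^+ 2).
    rewrite (bigD1 j)//= -[leLHS]addr0 lerD//; last first.
      by apply: sumr_ge0 => l _; rewrite divr_ge0 ?sqr_ge0.
    rewrite ler_pdivlMr ?exprn_gt0// mul1r -[leRHS]real_normK ?num_real//.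
    by rewrite lerXn2r ?nnegrE ?(ltW M0)// ltW.
  have : 2 * B * 1 <= 2 * B * \sum_j (Y s ord0 j ^+ 2 / M ^+ 2).
    by rewrite ler_wpM2l ?mulr_ge0.
  have := ler_normB (g (Y s)) (P (Y s)); have := gB (Y s).
  have : `|P (Y s)| <= B by apply: (bernstein_sin_bound gB).
  lra.
rewrite (le_trans (mean_dist D))// meanD mean_const// lerD2l meanZ.
apply: (@le_trans _ _ (2 * B * (k%:R / M ^+ 2))).
  by rewrite ler_wpM2l ?mulr_ge0// tail_bound.
apply: le_trans (ltW mC); rewrite -/M !mulrA ler_wpM2l ?mulr_ge0//.
by rewrite lef_pV2 ?posrE ?exprn_gt0// expr2 ler_peMr// ltW.
Qed.

End WeakLimit.

(** * Avoiding the corners *)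

Section Avoidance.
Variables (R : realType) (n : nat).
Local Notation E := (@unif_mean R 'S_n).

Definition avoids (L : seq ('I_n * 'I_n)) (s : 'S_n) : bool :=
  all (fun c => s c.1 != c.2) L.

Lemma mean_point (i c : 'I_n) (F : 'S_n -> R) :
  E (fun s => (s i == c)%:R * F s) = n%:R^-1 * E (fun s => F (move i c s)).
Proof.
rewrite (mean_move (fun d s => (d == c)%:R * F s)); congr (_ * _).
rewrite (bigD1 c)//= big1 ?addr0.
  by congr unif_mean; apply: funext => s; rewrite eqxx mul1r.
move=> d /negPf dc; rewrite -[RHS](mean_const (card_Sn_gt0 n) 0).
by congr unif_mean; apply: funext => s; rewrite dc mul0r.
Qed.

Lemma mean_point1 (i c : 'I_n) : E (fun s => (s i == c)%:R) = n%:R^-1.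
Proof.
have := mean_point i c (fun=> 1); rewrite mean_const// mulr1 => <-.
by congr unif_mean; apply: funext => s; rewrite mulr1.
Qed.

Lemma mean_image_in (i : 'I_n) (C : {set 'I_n}) :
  E (fun s => (s i \in C)%:R) = #|C|%:R / n%:R.
Proof.
have -> : (fun s : 'S_n => (s i \in C)%:R) = (fun s => \sum_(c in C) (s i == c)%:R) :> (_ -> R).
  apply: funext => s; case: (boolP (s i \in C)) => [sC|sC].
    rewrite (bigD1 (s i))//= eqxx big1 ?addr0// => c /andP[_ /negPf].
    by rewrite eq_sym => ->.
  by rewrite big1// => c cC; case: eqP => // e; rewrite e cC in sC.
rewrite mean_sum; under eq_bigr do rewrite mean_point1.
by rewrite sumr_const mulr_natl.
Qed.

Lemma mean_preimage_in (c : 'I_n) (A : {set 'I_n}) :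
  E (fun s => ((s^-1)%g c \in A)%:R) = #|A|%:R / n%:R.
Proof.
have -> : (fun s : 'S_n => ((s^-1)%g c \in A)%:R) = (fun s => \sum_(i in A) (s i == c)%:R) :> (_ -> R).
  apply: funext => s; case: (boolP (_ \in A)) => [sA|sA].
    rewrite (bigD1 ((s^-1)%g c))//= permKV eqxx big1 ?addr0// => i /andP[_ neq].
    by case: (s i =P c) => // e; rewrite -e permK eqxx in neq.
  by rewrite big1// => i iA; case: eqP => // e; rewrite -e permK iA in sA.
rewrite mean_sum; under eq_bigr do rewrite mean_point1.
by rewrite sumr_const mulr_natl.
Qed.

(** Only rows [i] and [s^-1 c] change. Row [s^-1 c] carries no cell of [L], and row [i] meets none
    with its old value, outside [C], nor with its new value [c]. *)
Lemma avoids_move (L : seq ('I_n * 'I_n)) (A C : {set 'I_n}) (i c : 'I_n) (s : 'S_n) :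
  (forall x, x \in L -> x.1 \in A /\ x.2 \in C) -> (i, c) \notin L ->
  s i \notin C -> (s^-1)%g c \notin A -> avoids L (move i c s) = avoids L s.
Proof.
move=> LAC icL siC scA; apply: eq_in_all => -[l d] ldL /=.
have [/= lA dC] := LAC _ ldL.
rewrite /move permM; case: tpermP => [/perm_inj li|slc|//].
  rewrite li in ldL *; have [cd|_] := eqVneq c d; first by rewrite cd ldL in icL.
  by case: eqP => // sid; rewrite sid dC in siC.
by rewrite -slc permK lA in scA.
Qed.

Lemma expRN_taylor (y : R) : 0 <= y -> `|1 - y - expR (- y)| <= y ^+ 2.
Proof.
move=> y0; have y1 : 0 < 1 + y by rewrite ltr_wpDr.
have lo : 1 - y <= expR (- y) by exact: expR_ge1Dx.
have up : expR (- y) <= 1 - y + y ^+ 2.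
  rewrite expRN (@le_trans _ _ (1 + y)^-1)//.
    by rewrite lef_pV2 ?posrE ?expR_gt0// expR_ge1Dx.
  rewrite -[leLHS]mul1r ler_pdivrMr//.
  have -> : (1 - y + y ^+ 2) * (1 + y) = 1 + y ^+ 3 by ring.
  by rewrite lerDl exprn_ge0.
by rewrite ler_norml; apply/andP; split; lra.
Qed.

Variables (A C : {set 'I_n}) (m : nat) (h : 'S_n -> R) (B D : R).
Hypothesis n_gt0 : (0 < n)%N.
Hypothesis Am : (#|A| <= m)%N.
Hypothesis Cm : (#|C| <= m)%N.
Hypothesis hB : forall s, `|h s| <= B.
Hypothesis hD : forall i c, E (fun s => `|h (move i c s) - h s|) <= D.

Let n0 : (0 : R) < n%:R. Proof. by rewrite ltr0n. Qed.

(** Changing [h] costs [D]. The avoidance indicator can change only if [s i] lies in [C] or [s^-1 c]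
    in [A], events of probability at most [m / n] each. *)
Lemma mean_avoids_move L i c :
  (forall x, x \in L -> x.1 \in A /\ x.2 \in C) -> (i, c) \notin L ->
  `|E (fun s => (avoids L (move i c s))%:R * h (move i c s))
    - E (fun s => (avoids L s)%:R * h s)| <= D + 2 * m%:R * B / n%:R.
Proof.
move=> LAC icL; have B0 : 0 <= B := le_trans (normr_ge0 _) (hB 1%g).
apply: le_trans (mean_dist (H := fun s => `|h (move i c s) - h s| +
   B * ((s i \in C)%:R + ((s^-1)%g c \in A)%:R)) _) _.
  move=> s; have -> (x y : bool) (u v : R) :
    x%:R * u - y%:R * v = x%:R * (u - v) + (x%:R - y%:R) * v by ring.
  rewrite (le_trans (ler_normD _ _))// lerD// normrM.
    by rewrite ler_piMl// ger0_norm// lern1 leq_b1.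
  rewrite mulrC; apply: ler_pM => //.
  have [siC|siC] := boolP (s i \in C).
    rewrite (@le_trans _ _ 1)// ?lerDl//.
    by case: (avoids L _); case: (avoids L s); rewrite ?subrr ?subr0 ?sub0r ?normrN ?normr0 ?normr1.
  have [scA|scA] := boolP ((s^-1)%g c \in A).
    rewrite (@le_trans _ _ 1)// ?lerDr//.
    by case: (avoids L _); case: (avoids L s); rewrite ?subrr ?subr0 ?sub0r ?normrN ?normr0 ?normr1.
  by rewrite (avoids_move LAC icL siC scA) subrr normr0 addr0.
rewrite meanD meanZ meanD mean_image_in mean_preimage_in lerD//.
rewrite -mulrDl mulrA ler_wpM2r ?invr_ge0// mulrC ler_wpM2r//.
have : #|A|%:R <= m%:R :> R by rewrite ler_nat.
have : #|C|%:R <= m%:R :> R by rewrite ler_nat.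
lra.
Qed.

Lemma mean_avoids L : uniq L -> (forall x, x \in L -> x.1 \in A /\ x.2 \in C) ->
  `|E (fun s => (avoids L s)%:R * h s) - expR (- ((size L)%:R / n%:R)) * E h| <=
  (size L)%:R / n%:R * (D + (2 * m%:R + 1) * B / n%:R).
Proof.
have B0 : 0 <= B := le_trans (normr_ge0 _) (hB 1%g).
elim: L => [|[i c] L IH] /= => [_ _|/andP[icL uL] LAC].
  rewrite !mul0r oppr0 expR0 mul1r (_ : (fun s => _) = h) ?subrr ?normr0//.
  by apply: funext => s; rewrite /avoids /= mul1r.
have LAC' x : x \in L -> x.1 \in A /\ x.2 \in C.
  by move=> xL; apply: LAC; rewrite inE xL orbT.
have {IH} := IH uL LAC'; have := mean_avoids_move LAC' icL.
have -> : E (fun s => (avoids ((i, c) :: L) s)%:R * h s) =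
    E (fun s => (avoids L s)%:R * h s)
    - n%:R^-1 * E (fun s => (avoids L (move i c s))%:R * h (move i c s)).
  rewrite -(mean_point i c (fun s => (avoids L s)%:R * h s)) -meanB.
  congr unif_mean; apply: funext => s; rewrite /avoids /=.
  by case: (s i == c) => /=; ring.
set q := E (fun s => _ * h (move i c s)); set p := E _; move=> qp pE.
rewrite -natr1; set l : R := (size L)%:R in pE *.
have l0 : 0 <= l by [].
set y := n%:R^-1 in qp pE *; have y0 : 0 <= y by rewrite invr_ge0.
have y1 : y <= 1 by rewrite invf_le1// ler1n.
have Eh : `|E h| <= B by apply: mean_bound.
have -> : expR (- ((l + 1) * y)) = expR (- (l * y)) * expR (- y).
  by rewrite -expRD -opprD mulrDl mul1r.
(* Three errors per added cell: the inductive one, contracted by [1 - y]; the Taylor error of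
   [expR (- y)]; and the effect of [move]. *)
have -> : p - y * q - expR (- (l * y)) * expR (- y) * E h =
  (1 - y) * (p - expR (- (l * y)) * E h) +
  (expR (- (l * y)) * E h * (1 - y - expR (- y)) - y * (q - p)) by ring.
have -> : (l + 1) * y * (D + (2 * m%:R + 1) * B * y) =
  l * y * (D + (2 * m%:R + 1) * B * y) + (B * y ^+ 2 + y * (D + 2 * m%:R * B * y)).
  by ring.
rewrite (le_trans (ler_normD _ _))// lerD//.
  rewrite normrM (le_trans _ pE)// ler_piMl// ger0_norm ?subr_ge0//.
  by rewrite lerBlDr lerDl.
rewrite (le_trans (ler_normB _ _))// lerD//.
  rewrite normrM [X in X * _ <= _]normrM ler_pM ?expRN_taylor ?mulr_ge0//.
  rewrite (le_trans _ Eh)// ler_piMl// ger0_norm ?expR_ge0//.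
  by rewrite expR_le1 oppr_le0 mulr_ge0.
by rewrite normrM ger0_norm// ler_wpM2l.
Qed.

End Avoidance.

(** * The board of large displacements *)

Section Corners.
Variables (n r : nat).
Hypothesis rn : (r < n)%N.

Lemma sum_ge_indicator a b : (\sum_(c < b) (a <= c : nat) = b - a)%N.
Proof. by elim: b => [|b IH]; rewrite ?big_ord0// big_ord_recr/= IH; case: leqP; lia. Qed.

Lemma sum_lt_indicator a b : (\sum_(c < b) (c < a : nat) = minn a b)%N.
Proof. by elim: b => [|b IH]; rewrite ?big_ord0 ?minn0// big_ord_recr/= IH; case: ltnP; lia. Qed.

Lemma sum_subn p q : (p <= q)%N -> (2 * \sum_(i < q) (p - i) = p * p.+1)%N.
Proof.
elim: q p => [|q IH] p pq; first by rewrite big_ord0; lia.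
case: (ltnP p q.+1) => pq'.
  by rewrite big_ord_recr/= mulnDr IH; lia.
case: p pq pq' => [|p] pq pq'; first by lia.
by rewrite big_ord_recl/= subn0 mulnDr; under eq_bigr do rewrite subSS; rewrite IH; lia.
Qed.

Definition corner_cells : seq ('I_n * 'I_n) :=
  [seq x : 'I_n * 'I_n <- enum {: 'I_n * 'I_n} | n <= `|x.2%:Z - x.1%:Z|%N + r]%N.

Lemma corner_cells_uniq : uniq corner_cells.
Proof. by rewrite filter_uniq// enum_uniq. Qed.

Lemma mem_corner_cells x : (x \in corner_cells) = (n <= `|x.2%:Z - x.1%:Z|%N + r)%N.
Proof. by rewrite mem_filter mem_enum andbT. Qed.

(** Row [i] has [r - i] cells at its right end and [r - rev_ord i] at its left, in truncated
    subtraction. The two corners are mirror images, each a triangle of [r (r + 1) / 2] cells. *)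
Lemma size_corner_cells : size corner_cells = (r * r.+1)%N.
Proof.
rewrite /corner_cells size_filter -sum1_count big_enum_cond/=.
rewrite big_mkcond/= -(pair_bigA _ (fun i c : 'I_n =>
  if (n <= `|c%:Z - i%:Z|%N + r)%N then 1 else 0)%N)/=.
have E1 (i : 'I_n) : (\sum_(c < n) (if (n <= `|c%:Z - i%:Z|%N + r)%N then 1 else 0) =
    (r - i) + (r - rev_ord i))%N.
  have ir := ltn_ord i.
  transitivity (\sum_(c < n) (i + n - r <= c : nat) + \sum_(c < n) (c < i + r + 1 - n : nat))%N.
    rewrite -big_split/=; apply: eq_bigr => c _; have := ltn_ord c.
    by case: (leqP n (`|c%:Z - i%:Z| + r)%N); case: (leqP (i + n - r)%N c);
      case: (ltnP c (i + r + 1 - n)%N) => /=; lia.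
  by rewrite sum_ge_indicator sum_lt_indicator/=; lia.
under eq_bigr do rewrite E1.
rewrite big_split/= [X in (_ + X)%N](_ : _ = \sum_(i < n) (r - i))%N; last first.
  by rewrite (reindex_inj rev_ord_inj)/=; apply: eq_bigr => i _; have := ltn_ord i; lia.
by rewrite addnn -mul2n sum_subn// ltnW.
Qed.

Definition border : {set 'I_n} := [set i : 'I_n | (i < r) || (n <= i + r)]%N%SET.

Lemma card_border : (#|border| <= 2 * r)%N.
Proof.
rewrite -sum1_card big_mkcond/=.
apply: (@leq_trans (\sum_(i < n) ((i < r : nat) + (n - r <= i : nat)))%N).
  by apply: leq_sum => i _; rewrite inE; case: (ltnP i r); case: (leqP (n - r)%N i);
    case: (leqP n (i + r)%N) => /=; lia.
by rewrite big_split/= sum_ge_indicator sum_lt_indicator; lia.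
Qed.

Lemma corner_cells_border x : x \in corner_cells -> x.1 \in border /\ x.2 \in border.
Proof.
rewrite mem_corner_cells !inE; have := ltn_ord x.1; have := ltn_ord x.2; lia.
Qed.

Lemma avoids_corner_cells (s : 'S_n) : avoids corner_cells s = (rho_infty s + r < n)%N.
Proof.
have -> : (rho_infty s + r < n = (rho_infty s <= n - r.+1))%N by lia.
apply/allP/bigmax_leqP => [H i _|H [i c]].
  rewrite leqNgt; apply/negP => Hi.
  have ge : (n <= displacement s i + r)%N by lia.
  have : (i, s i) \in corner_cells by rewrite mem_corner_cells.
  by move=> /H /=; rewrite eqxx.
rewrite mem_corner_cells /= => ic; apply/eqP => sic.
have := H i isT; rewrite /displacement sic.
by move: (absz _) ic => d; lia.
Qed.

End Corners.

(** * Asymptotic independence *)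

Section Gap.
Variable R : realType.

Definition gap n (s : 'S_n) : R := (Num.sqrt n%:R)^-1 * (n%:R - (rho_infty s)%:R).

Lemma rho_infty_lt n (s : 'S_n) : (0 < n)%N -> (rho_infty s < n)%N.
Proof.
case: n s => // n s _; rewrite ltnS; apply/bigmax_leqP => i _.
by have := ltn_ord i; have := ltn_ord (s i); rewrite /displacement; lia.
Qed.

(** As [n - rho_infty s] is a natural number, it exceeds a nonnegative real exactly when it exceeds
    its integer part. *)
Lemma lt_gap n (s : 'S_n) (x : R) : (0 < n)%N -> 0 <= x ->
  (x < gap s) = (rho_infty s + Num.trunc (x * Num.sqrt n%:R) < n)%N.
Proof.
move=> n0 x0; have rn := rho_infty_lt s n0.
have q0 : 0 < Num.sqrt n%:R :> R by rewrite sqrtr_gt0 ltr0n.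
rewrite /gap mulrC ltr_pdivlMr// -natrB ?(ltnW rn)//.
by rewrite -truncn_lt_nat ?mulr_ge0 ?(ltW q0)// ltn_subRL.
Qed.

Lemma gap_gt0 n (s : 'S_n) : (0 < n)%N -> 0 < gap s.
Proof. by move=> n0; rewrite lt_gap// mul0r truncn0 addn0 rho_infty_lt. Qed.

(** Stated in the mean, not uniformly in [s]: a bounded continuous function on R^k need not be
    uniformly continuous, so its change is controlled only where its argument is bounded. *)
Definition move_invariant (h : forall n, 'S_n -> R) := forall e : R, 0 < e ->
  \forall n \near \oo, forall i c : 'I_n,
    unif_mean (fun s : 'S_n => `|h n (move i c s) - h n s|) <= e.

Lemma cvgn_sqrt_lt (K e : R) : 0 < e -> \forall n \near \oo, K / Num.sqrt n%:R < e.
Proof.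
move=> e0; have /cvgrPdist_lt/(_ _ e0)[N _ NK] :
    (fun n : nat => K / Num.sqrt n%:R) @ \oo --> (0 : R).
  apply: (@cvgn_sqrt_small _ _ `|K|) => n n0.
  by rewrite normrM [X in _ * X]ger0_norm ?invr_ge0.
exists N => // n /NK /=; rewrite sub0r normrN; exact: le_lt_trans (ler_norm _).
Qed.

Lemma expRN_lipschitz (a b : R) : 0 <= a -> 0 <= b ->
  `|expR (- a) - expR (- b)| <= `|a - b|.
Proof.
wlog ab : a b / a <= b => [H a0 b0|a0 b0].
  case: (leP a b) => [ab|/ltW ba]; first exact: H.
  by rewrite distrC (distrC a) H.
rewrite ger0_norm ?subr_ge0 ?ler_expR ?lerN2// distrC ger0_norm ?subr_ge0//.
have -> : expR (- b) = expR (- a) * expR (- (b - a)).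
  by rewrite -expRD; congr expR; ring.
have -> : expR (- a) - expR (- a) * expR (- (b - a)) =
  expR (- a) * (1 - expR (- (b - a))) by ring.
apply: (@le_trans _ _ (1 - expR (- (b - a)))).
  rewrite ler_piMl ?subr_ge0 ?expR_le1 ?oppr_le0 ?subr_ge0//.
by rewrite lerBlDr addrC -lerBlDr expR_ge1Dx.
Qed.

Lemma mean_gap_tail (h : forall n, 'S_n -> R) (B x : R) : 0 <= x ->
  (forall n s, `|h n s| <= B) -> move_invariant h ->
  (fun n => unif_mean (fun s : 'S_n => (x < gap s)%R%:R * h n s)
            - expR (- x ^+ 2) * unif_mean (h n)) @ \oo --> (0 : R).
Proof.
move=> x0 hB hI; apply/cvgrPdist_le => e e0.
have B0 : 0 <= B := le_trans (normr_ge0 _) (hB 0%N 1%g).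
(* [c] bounds the ratio [a] of board size to [n] for every large [n], so an error [e / 2 / (c + 1)]
   per move costs at most [e / 2] in total. *)
pose c := x ^+ 2 + x; have c0 : 0 <= c by rewrite addr_ge0// exprn_ge0.
have c1 : 0 < c + 1 by rewrite ltr_wpDl.
have eD : 0 < e / 2 / (c + 1) by rewrite !divr_gt0.
have e2 : 0 < e / 2 by rewrite divr_gt0.
near=> n.
have n0 : (0 < n)%N by near: n; exists 1%N.
have hD : forall i d : 'I_n,
    unif_mean (fun s : 'S_n => `|h n (move i d s) - h n s|) <= e / 2 / (c + 1).
  by near: n; exact: hI.
have nR : (0 : R) < n%:R by rewrite ltr0n.
have q0 : 0 < Num.sqrt n%:R :> R by rewrite sqrtr_gt0.
have q1 : 1 <= Num.sqrt n%:R :> R by rewrite -[leLHS]sqrtr1 ler_wsqrtr// ler1n.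
have nE : n%:R = Num.sqrt n%:R ^+ 2 :> R by rewrite sqr_sqrtr// ltW.
set r := Num.trunc (x * Num.sqrt n%:R).
have xq0 : 0 <= x * Num.sqrt n%:R by rewrite mulr_ge0 ?(ltW q0).
have /andP[rlo rhi] : r%:R <= x * Num.sqrt n%:R < r.+1%:R by exact: truncn_itv.
have gapE (s : 'S_n) : (x < gap s) = (rho_infty s + r < n)%N by exact: lt_gap.
clearbody r.
have xn : x / Num.sqrt n%:R < 1 by near: n; exact: cvgn_sqrt_lt.
have rn : (r < n)%N.
    rewrite -(ltr_nat R) (le_lt_trans rlo)// {2}nE expr2 ltr_pM2r//.
  by move: xn; rewrite ltr_pdivrMr// mul1r.
have -> : (fun s : 'S_n => (x < gap s)%R%:R * h n s) =
    (fun s => (avoids (corner_cells n r) s)%:R * h n s).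
  by apply: funext => s; rewrite gapE avoids_corner_cells.
have := mean_avoids n0 (card_border rn) (card_border rn) (hB n) hD
  (corner_cells_uniq n r) (corner_cells_border rn (r := r)).
rewrite size_corner_cells//; set p := unif_mean _; set E := unif_mean _.
set a : R := (r * r.+1)%:R / n%:R => paE.
have EB : `|E| <= B by apply: mean_bound.
have a0 : 0 <= a by rewrite divr_ge0.
(* With [y = x sqrt n] and [r <= y < r + 1], the integer [r (r + 1)] is within [y] of [y^2]. *)
have ax : `|a - x ^+ 2| <= x / Num.sqrt n%:R.
  rewrite -(ler_pM2r nR) -{1}(gtr0_norm nR) -normrM mulrBl /a mulfVK ?gt_eqF//.
  move: nE q0 xq0 rlo rhi; move: (Num.sqrt n%:R) => q -> q0 xq0.
  rewrite natrM -natr1; move: (r%:R : R) (ler0n R r) => r' r'0 rlo rhi.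
  have -> : x / q * q ^+ 2 = x * q by field; rewrite gt_eqF.
  rewrite -exprMn ler_norml; move: (x * q) xq0 rlo rhi => y y0 rlo rhi.
  by apply/andP; split; nra.
have xc : x / Num.sqrt n%:R <= x by rewrite ler_pdivrMr// ler_peMr.
have ac : a <= c by move: ax; rewrite ler_norml /c => /andP[_]; lra.
rewrite sub0r normrN.
have -> : p - expR (- x ^+ 2) * E =
  (p - expR (- a) * E) + (expR (- a) - expR (- x ^+ 2)) * E by ring.
rewrite (le_trans (ler_normD _ _))//.
have t1 : `|(expR (- a) - expR (- x ^+ 2)) * E| <= x / Num.sqrt n%:R * B.
  rewrite normrM ler_pM// (le_trans (expRN_lipschitz _ _))// exprn_ge0//.
have t2 : a * (e / 2 / (c + 1) + (2 * (2 * r)%:R + 1) * B / n%:R) <=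
    e / 2 + c * (4 * x + 1) * B / Num.sqrt n%:R.
  rewrite mulrDr lerD//.
    by rewrite mulrA ler_pdivrMr// mulrC ler_wpM2l ?(ltW e2)//; lra.
  have -> : c * (4 * x + 1) * B / Num.sqrt n%:R =
    c * ((4 * x + 1) * B / Num.sqrt n%:R) by ring.
  rewrite ler_pM ?divr_ge0 ?mulr_ge0 ?addr_ge0//.
  rewrite ler_pdivrMr//; move: nE q0 q1 rlo; move: (Num.sqrt n%:R) => q -> q0 q1 rlo.
  have -> : (4 * x + 1) * B / q * q ^+ 2 = (4 * (x * q) + q) * B.
    by field; rewrite gt_eqF.
  by rewrite ler_wpM2r// natrM; lra.
have K : (c * (4 * x + 1) * B + x * B) / Num.sqrt n%:R < e / 2.
  by near: n; exact: cvgn_sqrt_lt.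
have := paE; lra.
Unshelve. all: by end_near. Qed.

Lemma move_invariant1 : move_invariant (fun n s => 1).
Proof.
move=> e e0; exists 0%N => // n _ i c /=.
have -> : (fun s : 'S_n => `|1 - 1| : R) = fun=> 0.
  by apply: funext => s; rewrite subrr normr0.
by rewrite mean_const// ltW.
Qed.

(** [f] is replaced by a step function on a grid of [0, A], and [F] is its integral against the law
    with tail [exp (- x^2)]. The essential point is that [F] is chosen before [h]. *)
Lemma mean_gap_approx (f : R -> R) (Bf B e : R) : continuous f ->
  (forall x, `|f x| <= Bf) -> 0 <= B -> 0 < e ->
  exists F, forall h : forall n, 'S_n -> R,
    (forall n s, `|h n s| <= B) -> move_invariant h ->
    \forall n \near \oo,
      `|unif_mean (fun s : 'S_n => f (gap s) * h n s) - F * unif_mean (h n)| <= e.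
Proof.
move=> cf fB B0 e0; have Bf0 : 0 <= Bf := le_trans (normr_ge0 _) (fB 0).
(* The error [e] is split into [e / 4] for the mesh, through [u], [e / 4] for gaps beyond [A],
   through [v], and [e / 2] for the limit of the step function. *)
pose u := e / (4 * (B + 1)); have u0 : 0 < u by rewrite divr_gt0// mulr_gt0// ltr_wpDl.
have BBf : 0 <= B * Bf by rewrite mulr_ge0.
pose v := e / (8 * (B * Bf + 1)); have v0 : 0 < v by rewrite divr_gt0// mulr_gt0// ltr_wpDl.
(* Chosen so that [v^-1 <= A <= A^2 <= exp (A^2)]. *)
pose A := v^-1 + 1; have A1 : 1 <= A by rewrite lerDr invr_ge0 ltW.
have A0 : 0 < A by rewrite (lt_le_trans _ A1).
have expA : expR (- A ^+ 2) <= v.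
  rewrite expRN -[leRHS]invrK lef_pV2 ?posrE ?expR_gt0 ?invr_gt0//.
  rewrite (le_trans _ (expR_ge1Dx _))// (@le_trans _ _ A)//; first by rewrite /A lerDl.
  by rewrite (@le_trans _ _ (A ^+ 2)) ?lerDr// expr2 ler_peMr// ltW.
have [d d0 fd] := compact_unif_continuous (@segment_compact R 0 A) cf u0.
have [N _ /(_ N.+1 (leqnSn _)) Nd] := cvgn_invn_small A d0.
pose x (j : nat) : R := A * (j%:R / N.+1%:R).
have NR : 0 < N.+1%:R :> R by rewrite ltr0n.
have x0 j : 0 <= x j by rewrite mulr_ge0 ?divr_ge0 ?(ltW A0).
have xS j : x j <= x j.+1 by rewrite ler_wpM2l ?(ltW A0)// ler_wpM2r ?invr_ge0// ler_nat.
have x00 : x 0%N = 0 by rewrite /x mul0r mulr0.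
have xN : x N.+1 = A by rewrite /x mulfV ?mulr1// gt_eqF.
pose I n j (s : 'S_n) : R := (x j < gap s)%R%:R.
pose phi n (s : 'S_n) := \sum_(j < N.+1) f (x j) * (I n j s - I n j.+1 s).
pose q j := expR (- x j ^+ 2).
exists (\sum_(j < N.+1) f (x j) * (q j - q j.+1)) => h hB hI.
have phi_dist n (s : 'S_n) : (0 < n)%N -> `|f (gap s) - phi n s| <= u + Bf * (A < gap s)%R%:R.
  move=> n0.
  (* The differences are the indicators of the grid cells; they telescope, and the first indicator
     is 1 because the gap is positive. *)
  have tel : \sum_(j < N.+1) (I n j s - I n j.+1 s) = 1 - (A < gap s)%R%:R.
    rewrite -(big_mkord xpredT (fun j => I n j s - I n j.+1 s)).
    rewrite (eq_bigr (fun j => - I n j.+1 s - - I n j s)) => [|j _]; last by ring.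
    rewrite (telescope_sumr (fun j => - I n j s) (leq0n N.+1)).
    by rewrite /I x00 xN gap_gt0// opprK addrC.
  have I_ge0 j : 0 <= I n j s - I n j.+1 s.
    rewrite subr_ge0 /I ler_nat.
    by case: (ltP (x j.+1) (gap s)) => // /(le_lt_trans (xS j)) ->.
  have -> : f (gap s) - phi n s = f (gap s) * (A < gap s)%R%:R +
      \sum_(j < N.+1) (f (gap s) - f (x j)) * (I n j s - I n j.+1 s).
    under eq_bigr do rewrite mulrBl.
    by rewrite sumrB -mulr_sumr tel /phi; ring.
  rewrite addrC (le_trans (ler_normD _ _))// lerD//; last first.
    by rewrite normrM [`|_%:R|]ger0_norm// ler_wpM2r.
  apply: (@le_trans _ _ (\sum_(j < N.+1) u * (I n j s - I n j.+1 s))); last first.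
    by rewrite -mulr_sumr tel ler_piMr ?(ltW u0)// lerBlDr lerDl.
  rewrite (le_trans (ler_norm_sum _ _ _))// ler_sum// => j _.
  rewrite normrM [X in _ * X]ger0_norm//.
  have [gj|gj] := ltP (x j) (gap s); last first.
    by rewrite /I !ltNge gj (le_trans gj)//= subrr !mulr0.
  have [gj1|gj1] := ltP (x j.+1) (gap s); first by rewrite /I gj gj1 subrr !mulr0.
  rewrite ler_wpM2r// distrC ltW// fd//=.
    rewrite in_itv/= x0/= -xN /x ler_wpM2l ?(ltW A0)// ler_wpM2r ?invr_ge0// ler_nat.
    exact: ltnW.
  rewrite -ball_normE/= ltr0_norm ?subr_lt0// opprB (le_lt_trans _ Nd)//.
  rewrite (@le_trans _ _ (x j.+1 - x j)) ?lerB// /x -mulrBr ler_wpM2l ?(ltW A0)//.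
  by rewrite -natr1 mulrDl mul1r addrC addKr.
have phi_lim : (fun n => unif_mean (fun s => phi n s * h n s) -
    (\sum_(j < N.+1) f (x j) * (q j - q j.+1)) * unif_mean (h n)) @ \oo --> (0 : R).
  pose w j n := unif_mean (fun s => I n j s * h n s) - q j * unif_mean (h n).
  have w0 j : w j @ \oo --> (0 : R) by exact: mean_gap_tail.
  have -> : (fun n => unif_mean (fun s => phi n s * h n s) -
      (\sum_(j < N.+1) f (x j) * (q j - q j.+1)) * unif_mean (h n)) =
      fun n => \sum_(j < N.+1) f (x j) * (w j n - w j.+1 n).
    apply: funext => n.
    have -> : (fun s => phi n s * h n s) =
        fun s => \sum_(j < N.+1) f (x j) * (I n j s * h n s - I n j.+1 s * h n s).
      by apply: funext => s; rewrite mulr_suml; apply: eq_bigr => j _; ring.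
    rewrite mean_sum mulr_suml -sumrB; apply: eq_bigr => j _.
    by rewrite meanZ meanB /w; ring.
  suff : (fun n => \sum_(j < N.+1) f (x j) * (w j n - w j.+1 n)) @ \oo -->
      (\sum_(j < N.+1) f (x j) * (0 - 0) : R).
    by rewrite [\sum_(j < N.+1) _ * (0 - 0)]big1// => j _; rewrite subrr mulr0.
  apply: cvg_big => [|j _]; first exact: add_continuous.
  by apply: cvgM; [exact: cvg_cst|exact: cvgB].
(* With [h] constant, the same tail lemma bounds the probability of a gap beyond [A], eventually by
   [2 * v]. *)
have tailA : (fun n => unif_mean (fun s : 'S_n => (A < gap s)%R%:R * 1)
            - expR (- A ^+ 2) * unif_mean (fun s : 'S_n => 1 : R)) @ \oo --> (0 : R).
  apply: (@mean_gap_tail (fun n s => 1) 1); rewrite ?(ltW A0)//.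
    by move=> n s; rewrite normr1.
  exact: move_invariant1.
have e2 : 0 < e / 2 by rewrite divr_gt0.
have /cvgrPdist_le phi_le := phi_lim; have /cvgrPdist_le tail_le := tailA.
near=> n.
have n0 : (0 < n)%N by near: n; exists 1%N.
have : `|0 - (unif_mean (fun s => phi n s * h n s) -
    (\sum_(j < N.+1) f (x j) * (q j - q j.+1)) * unif_mean (h n))| <= e / 2.
  by near: n; exact: phi_le.
have : `|0 - (unif_mean (fun s : 'S_n => (A < gap s)%R%:R * 1)
            - expR (- A ^+ 2) * unif_mean (fun s : 'S_n => 1 : R))| <= v.
  by near: n; exact: tail_le.
rewrite mean_const// mulr1 !sub0r !normrN.
under eq_fun do rewrite mulr1.
set P := unif_mean _; move=> PA.
have PB : P <= 2 * v by move: PA; rewrite ler_norml => /andP[_]; lra.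
set p := unif_mean _; set F := \sum_(j < _) _; move=> pF.
have fp : `|unif_mean (fun s : 'S_n => f (gap s) * h n s) - p| <= B * (u + Bf * P).
  rewrite -meanZ -(mean_const (card_Sn_gt0 n) u) -meanD -meanZ.
  apply: mean_dist => s; rewrite -mulrBl normrM mulrC ler_pM//.
  exact: phi_dist.
rewrite (le_trans (ler_distD p _ _))// [leRHS]splitr lerD//.
rewrite (le_trans fp)//.
have uB : B * u <= e / 4.
  rewrite /u mulrA ler_pdivrMr ?mulr_gt0 ?ltr_wpDl//; nra.
have vB : B * Bf * (2 * v) <= e / 4.
  rewrite /v; have w1 : 0 < B * Bf + 1 by rewrite ltr_wpDl.
  have -> : B * Bf * (2 * (e / (8 * (B * Bf + 1)))) = B * Bf * e / 4 / (B * Bf + 1).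
    by field; rewrite gt_eqF.
  rewrite ler_pdivrMr//; nra.
have : B * Bf * P <= B * Bf * (2 * v) by rewrite ler_wpM2l.
by rewrite mulrDr mulrA; lra.
Unshelve. all: by end_near. Qed.

End Gap.

Section Independence.
Variables (R : realType) (k : nat).

Lemma mean_rho_vec_sq n (j : 'I_k) :
  unif_mean (fun s : 'S_n => rho_vec R k s ord0 j ^+ 2) <= 1.
Proof.
under eq_fun do rewrite mxE.
exact: mean_rho_std_sq.
Qed.

(** On a box [g] is uniformly continuous and [move] shifts each coordinate by O(1/sqrt n); off the
    box the second moments bound the probability. *)
Lemma rho_vec_move_invariant (g : 'rV[R]_k -> R) (B : R) : continuous g ->
  (forall x, `|g x| <= B) -> move_invariant (fun n s => g (rho_vec R k s)).
Proof.
move=> cg gB e e0; have e2 : 0 < e / 2 by rewrite divr_gt0.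
have B0 : 0 <= B := le_trans (normr_ge0 _) (gB 0).
have [m _ /(_ m.+1 (leqnSn _)) mC] := cvgn_invn_small (2 * B * k%:R) e2.
pose M : R := m.+1%:R; have M1 : 1 <= M by rewrite ler1n.
have M0 : 0 < M by rewrite (lt_le_trans _ M1).
have [d d0 gd] := unif_continuous_box M cg e2.
have [C C0 YC] := rho_std_move R k.
have [N _ NC] := cvgn_sqrt_lt C d0.
exists N => // n /NC /= Cd i c.
have D (s : 'S_n) : `|g (rho_vec R k (move i c s)) - g (rho_vec R k s)| <=
    e / 2 + 2 * B * \sum_j (rho_vec R k s ord0 j ^+ 2 / M ^+ 2).
  have S0 : 0 <= \sum_j (rho_vec R k s ord0 j ^+ 2 / M ^+ 2).
    by apply: sumr_ge0 => j _; rewrite divr_ge0 ?sqr_ge0.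
  have [/forallP YM|] := boolP [forall j, `|rho_vec R k s ord0 j| <= M].
    rewrite -[leLHS]addr0 lerD ?mulr_ge0// distrC ltW// gd// => j.
    by rewrite !mxE distrC (le_lt_trans (YC _ _ _ _ _)).
  rewrite negb_forall => /existsP[j]; rewrite -ltNge => Mj.
  have S1 : 1 <= \sum_j (rho_vec R k s ord0 j ^+ 2 / M ^+ 2).
    rewrite (bigD1 j)//= -[leLHS]addr0 lerD//; last first.
      by apply: sumr_ge0 => l _; rewrite divr_ge0 ?sqr_ge0.
    rewrite ler_pdivlMr ?exprn_gt0// mul1r -[leRHS]real_normK ?num_real//.
    by rewrite lerXn2r ?nnegrE ?(ltW M0)// ltW.
  have : 2 * B * 1 <= 2 * B * \sum_j (rho_vec R k s ord0 j ^+ 2 / M ^+ 2).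
    by rewrite ler_wpM2l ?mulr_ge0.
  have := ler_normB (g (rho_vec R k (move i c s))) (g (rho_vec R k s)).
  have := gB (rho_vec R k (move i c s)); have := gB (rho_vec R k s); lra.
rewrite (le_trans (mean_le D))// meanD mean_const// [leRHS]splitr lerD2l meanZ.
apply: (@le_trans _ _ (2 * B * (k%:R / M ^+ 2))).
  rewrite ler_wpM2l ?mulr_ge0//.
  apply: (@tail_bound R k (fun n => 'S_n) (fun n s => rho_vec R k s)) => // l j.
  exact: mean_rho_vec_sq.
apply: le_trans (ltW mC); rewrite -/M !mulrA ler_wpM2l ?mulr_ge0//.
by rewrite lef_pV2 ?posrE ?exprn_gt0// expr2 ler_peMr// ltW.
Qed.

End Independence.

Theorem theorem7p2 (R : realType) (k : nat) :
  @weakly_asymptotically_independent R k (fun n => 'S_n)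
    (fun n s => (Num.sqrt n%:R)^-1 * (n%:R - (rho_infty s)%:R))
    (fun n s => \row_(j < k) standardize (@rho R n (j.+1)%:R) s).
Proof.
(* [bounded_fun] supplies a bound for every constant strictly above a threshold, whence the added
   1. *)
move=> f g cf [Bf [_ /(_ (Bf + 1))fB]] cg [Bg [_ /(_ (Bg + 1))gB]] Ef Eg Efg.
have {}fB x : `|f x| <= Bf + 1 by apply: fB; rewrite ?ltrDl.
have {}gB x : `|g x| <= Bg + 1 by apply: gB; rewrite ?ltrDl.
have Bg0 : 0 <= Bg + 1 := le_trans (normr_ge0 _) (gB 0).
have EgC : cvgn Eg.
  apply: (@weak_limit R k (fun n => 'S_n) (fun n s => rho_vec R k s) _ _ _ g _ cg gB) => //.
  - by move=> t b; exact: cvgn_charfun_rho.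
  - by move=> n j; exact: mean_rho_vec_sq.
have gI := rho_vec_move_invariant cg gB.
pose B := Num.max 1 (Bg + 1).
have B0 : 0 <= B by rewrite le_max ler01.
(* One constant [F] serves both [h = 1] and [h = g(Y)]: it approximates [Ef n], while [F * Eg n]
   approximates [Efg n]. Eliminating [F] yields the product rule. *)
have approx (e : R) : 0 < e -> exists F : R,
    (\forall n \near \oo, `|F - Ef n| <= e) /\
    (\forall n \near \oo, `|Efg n - F * Eg n| <= e).
  move=> e0; have [F FP] := mean_gap_approx cf fB B0 e0; exists F; split.
    have := FP (fun n s => 1) _ (@move_invariant1 R).
    have B1 n (s : 'S_n) : `|1 : R| <= B by rewrite normr1 le_max lexx.
    move=> /(_ B1); apply: filterS => n.
    rewrite mean_const// mulr1 distrC; under eq_fun do rewrite mulr1.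
    by [].
  by apply: FP gI => n s; rewrite le_max gB orbT.
have EfC : cvgn Ef.
  apply: cvgn_approx => e e0; have e2 : 0 < e / 2 by rewrite divr_gt0.
  have [F [Fn _]] := approx _ e2; exists F; apply: filterS Fn => n Fn.
  by rewrite (le_lt_trans Fn)// ltr_pdivrMr// ltr_pMr// ltr1n.
have EgB n : `|Eg n| <= Bg + 1 by apply: mean_bound => // s; exact: gB.
have D : (fun n => Efg n - Ef n * Eg n) @ \oo --> (0 : R).
  apply/cvgrPdist_le => e e0.
  have e1 : 0 < e / (1 + (Bg + 1)) by rewrite divr_gt0// ltr_pwDl.
  have [F [Fn FgN]] := approx _ e1; apply: filterS2 Fn FgN => n Fn Fgn.
  rewrite sub0r normrN.
  have -> : Efg n - Ef n * Eg n = (Efg n - F * Eg n) + (F - Ef n) * Eg n by ring.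
  rewrite (le_trans (ler_normD _ _))//.
  have -> : e = e / (1 + (Bg + 1)) + e / (1 + (Bg + 1)) * (Bg + 1).
    by field; rewrite gt_eqF// ltr_pwDl.
  by rewrite lerD// normrM ler_pM.
have EfgC := cvgn_near_dist0 D (cvgnM EfC EgC).
split=> //.
have EfEg : (fun n => Ef n * Eg n) @ \oo --> limn Ef * limn Eg by exact: cvgM.
rewrite -[RHS]add0r; apply: cvg_lim => //.
have -> : Efg = fun n => (Efg n - Ef n * Eg n) + Ef n * Eg n.
  by apply: funext => n; rewrite subrK.
exact: cvgD D EfEg.
Qed.
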